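(* Let $\mathcal{A}=V(\ell_0\cdots\ell_n)\subseteq\mathbb{C}^d$ be an essential non-central arrangement of $n+1$ hyperplanes with $\ell_0,\dots,\ell_n$ affine-linear with real coefficients, let $X=\mathbb{C}^d\setminus\mathcal{A}$, and let $r$ be the number of bounded connected components of $X\cap\mathbb{R}^d$. Then for any $u\in\mathbb{R}_+^{n+1}$, the critical scheme $\mathrm{Crit}_X(u)$ consists of $r$ reduced points. If $\mathcal{A}$ has no flats at infinity, then $\nabla_{\log}(X)\cap\mathbb{R}_+^{n+1}=\emptyset$, i.e. no $u\in\mathbb{R}^{n+1}_+$ represents a point of $\nabla_{\log}(X)\subseteq\mathbb{P}^n$.
   Context: Here $n\ge d\ge1$. Write $(\ell_0(x),\dots,\ell_n(x))^{T}=Ax+b$ and $L^{T}=[\,b\mid A\,]$; essential and non-central mean $\operatorname{rank}L=d+1$ and $\operatorname{rank}A=d$. $\mathbb{R}_+$ denotes the strictly positive reals. For $u\in\mathbb{C}^{n+1}$ let $\mathcal{L}_u(x)=\sum_i u_i\log\ell_i(x)$, and let $\mathrm{Crit}_X(u)\subseteq X$ be the subscheme defined by $\partial\mathcal{L}_u/\partial x_j=0$, $j=1,\dots,d$. The logarithmic discriminant is $\nabla_{\log}(X)=\overline{\{u\in\mathbb{P}^n:\mathrm{Crit}_X(u)\text{ is infinite or non-reduced}\}}$. Let $H_i\subseteq\mathbb{P}^d$ be the projective closure of the hyperplane $V(\ell_i)\subset\mathbb{C}^d\subset\mathbb{P}^d$. The flats are the intersections of subsets of $\{H_0,\dots,H_n\}$.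 $\mathcal{A}$ has no flats at infinity if no non-empty flat is contained in $\mathbb{P}^d\setminus\mathbb{C}^d$. *)

(* Defs.v *)
(* The real numbers are an arbitrary [realType] R, the complex numbers R[i]. *)
From HB Require Import structures.
From mathcomp Require Import all_boot all_order all_algebra.
From mathcomp Require Import fraction complex mpoly.
From mathcomp Require Import boolp classical_sets functions cardinality.
From mathcomp Require Import reals topology normedtype.

Set Implicit Arguments.
Unset Strict Implicit.
Unset Printing Implicit Defensive.

Import Order.TTheory GRing.Theory Num.Theory.
Import numFieldNormedType.Exports.

Local Open Scope classical_set_scope.
Local Open Scope ring_scope.

(* The forms l_i and the partial derivatives of L_u = \sum_i u_i log l_i make
   sense over any field; below they are used both at points of C^d and at the
   generic point, with coordinates in the function field of C^d.             *)
Definition ell (K : fieldType) n d (A : 'M[K]_(n, d)) (b : 'cV[K]_n)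
  (x : 'cV[K]_d) (i : 'I_n) : K := (A *m x + b) i 0.

Definition dlog (K : fieldType) n d (A : 'M[K]_(n, d)) (b u : 'cV[K]_n)
  (x : 'cV[K]_d) (j : 'I_d) : K := \sum_(i < n) u i 0 * A i j / ell A b x i.

Section Arrangement.
Variables (R : realType) (n d : nat).
Local Notation C := (R[i]).
Implicit Types (A : 'M[C]_(n, d)) (b u : 'cV[C]_n).

Definition affine_hyperplane A b (i : 'I_n) : set 'cV[C]_d :=
  [set x | ell A b x i = 0].

(* V(l_0), ..., V(l_{n-1}) are n (distinct) hyperplanes. *)
Definition is_arrangement A b : Prop :=
  (forall i, row i A != 0) /\ injective (affine_hyperplane A b).

Definition Lmx A b : 'M[C]_(1 + d, n) := (row_mx b A)^T.

Definition essential_noncentral A b : Prop :=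
  \rank (Lmx A b) = d.+1 /\ \rank A = d.

Definition complement A b : set 'cV[C]_d := [set x | forall i, ell A b x i != 0].

Definition crit_points A b u : set 'cV[C]_d :=
  complement A b `&` [set x | forall j, dlog A b u x j = 0].

Definition funfield : fieldType := {fraction {mpoly C[d]}}.

Definition to_ff (c : C) : funfield := tofrac (c%:MP : {mpoly C[d]}).

Definition generic_point : 'cV[funfield]_d :=
  \col_j tofrac ('X_j : {mpoly C[d]}).

Definition ell_gen A b (i : 'I_n) : funfield :=
  ell (map_mx to_ff A) (map_mx to_ff b) generic_point i.

Definition dlog_gen A b u (j : 'I_d) : funfield :=
  dlog (map_mx to_ff A) (map_mx to_ff b) (map_mx to_ff u) generic_point j.

(* C[X]: the localization of C[x_1, ..., x_d] at the product of the l_i. *)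
Definition coord_ring A b : set funfield :=
  [set f | exists (g : {mpoly C[d]}) (k : nat),
     f = tofrac g / (\prod_(i < n) ell_gen A b i) ^+ k].

(* The ideal of Crit_X(u) in C[X]. *)
Definition crit_ideal A b u : set funfield :=
  [set f | exists2 g : 'I_d -> funfield, forall j, coord_ring A b (g j) &
     f = \sum_(j < d) g j * dlog_gen A b u j].

(* The affine scheme Crit_X(u) is reduced iff C[X] / crit_ideal has no nonzero
   nilpotent element.                                                        *)
Definition crit_reduced A b u : Prop :=
  forall (f : funfield) (m : nat), coord_ring A b f ->
    crit_ideal A b u (f ^+ m) -> crit_ideal A b u f.

End Arrangement.

(* A subset of P^{m-1} is given by the nonzero vectors of C^m representing its
   points.                                                                    *)
Definition pspace (R : realType) (m : nat) : set 'cV[R[i]]_m :=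
  [set p | p != 0].

(* Zariski closure in P^{m-1}: common zeros of the homogeneous polynomials that
   vanish on S.                                                               *)
Definition zclosure (R : realType) (m : nat) (S : set 'cV[R[i]]_m) :
    set 'cV[R[i]]_m :=
  @pspace R m `&`
  [set p | forall (k : nat) (F : {mpoly R[i][m]}), F \is k.-homog ->
     (forall q, S q -> F.@[fun i => q i 0] = 0) -> F.@[fun i => p i 0] = 0].

Section Projective.
Variables (R : realType) (n d : nat).
Local Notation C := (R[i]).
Implicit Types (A : 'M[C]_(n, d)) (b : 'cV[C]_n).

Definition log_disc A b : set 'cV[C]_n :=
  zclosure (@pspace R n `&`
    [set u | infinite_set (crit_points A b u) \/ ~ crit_reduced A b u]).

(* x |-> (1 : x_1 : ... : x_d) embeds C^d in P^d. *)
Definition affine_chart (x : 'cV[C]_d) : 'cV[C]_(1 + d) :=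
  col_mx (const_mx 1) x.

Definition at_infinity : set 'cV[C]_(1 + d) :=
  @pspace R (1 + d) `&` [set p | usubmx p = 0].

Definition proj_hyperplane A b (i : 'I_n) : set 'cV[C]_(1 + d) :=
  zclosure (affine_chart @` affine_hyperplane A b i).

(* The empty intersection is P^d. *)
Definition flat A b (J : set 'I_n) : set 'cV[C]_(1 + d) :=
  @pspace R (1 + d) `&` \bigcap_(i in J) proj_hyperplane A b i.

Definition no_flats_at_infinity A b : Prop :=
  forall J : set 'I_n, flat A b J !=set0 -> ~ (flat A b J `<=` at_infinity).

End Projective.

Definition cplx (R : realType) (m p : nat) (M : 'M[R]_(m, p)) : 'M[R[i]]_(m, p) :=
  map_mx (real_complex R) M.

Definition components (T : topologicalType) (S : set T) : set (set T) :=
  [set B | exists2 x, S x & B = connected_component S x].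

(* The bounded connected components of X \cap R^d. *)
Definition bounded_regions (R : realType) (n d : nat)
    (A : 'M[R]_(n, d)) (b : 'cV[R]_n) : set (set 'cV[R]_d) :=
  components [set x : 'cV[R]_d | complement (cplx A) (cplx b) (cplx x)]
  `&` [set B | bounded_set B].

(* Main.v *)
From mathcomp Require Import all_boot all_order all_algebra.
From mathcomp Require Import fraction complex mpoly.
From mathcomp Require Import boolp classical_sets functions cardinality reals.
From mathcomp Require Import topology normedtype sequences derive exp.
From mathcomp Require lebesgue_measure.
From mathcomp Require Import ring lra.
Require Import Defs.

(** Write [L_u = sum_i u_i log l_i] for a positive weight vector [u].

    All critical points of [L_u] are real ([critical_real]): the imaginary part
    of the critical equations is a linear system with a positive definite matrix.
    They are nondegenerate ([det_hess_neq0]), because minus the Hessian is the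
    positive definite form [sum_i u_i (a_i . v)^2 / l_i^2].  On a bounded region
    [L_u] has a maximum ([bounded_cell_critical]).  Conversely, if [x] is critical,
    then [sum_i u_i l_i(y) / l_i(x)] does not depend on [y]; this bounds the region
    of [x] ([critical_cell_bounded]) and, with [r + 1/r >= 2], excludes a second
    critical point there ([critical_cell_unique]).  So critical points correspond
    to bounded regions.

    Reducedness is algebra.  Present the coordinate ring of the complement by the
    coordinates and the inverses of the [l_i].  Subtracting from the critical
    equations their values at a critical point [x] shows, by Cramer's rule, that
    the determinant of a matrix specializing to the Hessian at [x] multiplies the
    ideal of [x] into the critical ideal ([crit_ideal_isolated]).  With the
    Nullstellensatz, nondegeneracy of all critical points makes the critical
    ideal radical ([crit_ideal_radical]) and its zeros finite in number
    ([finite_critical_points]).  As the complex field is uncountable, the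
    Nullstellensatz has a short proof by counting dimensions
    ([adjoin_value_proper]).

    Hence a weight vector with an infinite or non-reduced critical scheme has a
    degenerate critical point, and the second claim says that having none is a
    Zariski open condition at [u] ([nondegenerate_open]).  Put the critical points
    [x] of all weight vectors in one projective space as
    [1 : 1 / l_0(x) : ... : 1 / l_n(x)].  The projection from there to weight space
    is closed ([elimination]), so it suffices that the closure of the set of
    degenerate critical points has no point above [u] ([fiber_trivial]).  In the
    closure some coordinates may vanish, but the remaining ones are still the
    reciprocals of the values of their linear forms at a common point, and pairing
    the critical equations with that point gives a vanishing sum of the
    corresponding weights, including the weight [- sum_i u_i] of the hyperplane
    at infinity.  For positive [u] only the sum of all the weights vanishes, so the
    point comes from a degenerate critical point of [u], which does not exist. *)

Set Implicit Arguments.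
Unset Strict Implicit.
Unset Printing Implicit Defensive.

Import Order.TTheory GRing.Theory Num.Theory.
Import numFieldNormedType.Exports.

Local Open Scope classical_set_scope.
Local Open Scope card_scope.
Local Open Scope ring_scope.

(** * Ideals and the Nullstellensatz over uncountable fields *)

Record is_ideal (T : comNzRingType) (I : set T) : Prop := IsIdeal {
  ideal0 : I 0;
  idealD : forall x y, I x -> I y -> I (x + y);
  idealM : forall a x, I x -> I (a * x) }.

Section IdealTheory.
Variables (T : comNzRingType) (I : set T).
Hypothesis idI : is_ideal I.

Lemma idealN x : I x -> I (- x).
Proof. by move=> Ix; rewrite -mulN1r; apply: idealM. Qed.

Lemma idealB x y : I x -> I y -> I (x - y).
Proof. by move=> Ix Iy; apply: (idealD idI) => //; apply: idealN. Qed.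

Lemma idealMr x a : I x -> I (x * a).
Proof. by rewrite mulrC; apply: idealM. Qed.

Lemma ideal_sum (J : Type) (r : seq J) (P : pred J) (F : J -> T) :
  (forall j, P j -> I (F j)) -> I (\sum_(j <- r | P j) F j).
Proof. by move=> IF; apply: big_ind => //; [exact: ideal0|exact: idealD]. Qed.

Lemma ideal_congr x y : I (x - y) -> I y -> I x.
Proof. by move=> Ixy Iy; rewrite -(subrK y x); apply: (idealD idI). Qed.

End IdealTheory.

Definition ideal_adjoin (T : comNzRingType) (I : set T) (g : T) : set T :=
  [set h | exists a, I (h - a * g)].

Lemma ideal_adjoin_ideal (T : comNzRingType) (I : set T) (g : T) :
  is_ideal I -> is_ideal (ideal_adjoin I g).
Proof.
move=> idI; split.
- by exists 0; rewrite mul0r subr0; apply: ideal0.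
- move=> x y [a Ia] [b Ib]; exists (a + b).
  by rewrite mulrDl opprD addrACA; apply: idealD.
- by move=> c x [a Ia]; exists (c * a); rewrite -mulrA -mulrBr; apply: idealM.
Qed.

Lemma sub_ideal_adjoin (T : comNzRingType) (I : set T) (g x : T) :
  I x -> ideal_adjoin I g x.
Proof. by move=> Ix; exists 0; rewrite mul0r subr0. Qed.

Lemma ideal_adjoin_gen (T : comNzRingType) (I : set T) (g : T) :
  is_ideal I -> ideal_adjoin I g g.
Proof. by move=> idI; exists 1; rewrite mul1r subrr; apply: ideal0. Qed.

Definition colon_ideal (T : comNzRingType) (I : set T) (f : T) : set T :=
  [set g | I (g * f)].

Lemma colon_ideal_ideal (T : comNzRingType) (I : set T) (f : T) :
  is_ideal I -> is_ideal (colon_ideal I f).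
Proof.
move=> idI; rewrite /colon_ideal; split => [|x y|a x] /=.
- by rewrite mul0r; apply: ideal0.
- by rewrite mulrDl; apply: idealD.
- by rewrite -mulrA; apply: idealM.
Qed.

(** A polynomial differs from its value at [c] by an element of the ideal of
    the point [c]; multiplying by a fixed [e] lets the same induction serve when
    only the multiples by [e] of the coordinate functions are known to lie in
    the ideal. *)
Lemma ideal_sub_value (K : fieldType) (m : nat) (I : set {mpoly K[m]})
    (e : {mpoly K[m]}) (c : 'I_m -> K) :
  is_ideal I -> (forall i, I (e * ('X_i - (c i)%:MP))) ->
  forall h : {mpoly K[m]}, I (e * (h - (h.@[c])%:MP)).
Proof.
move=> idI Ic.
have mulP (f g : {mpoly K[m]}) : I (e * (f - (f.@[c])%:MP)) ->
    I (e * (g - (g.@[c])%:MP)) -> I (e * (f * g - ((f * g).@[c])%:MP)).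
  move=> If Ig; rewrite mevalM mpolyCM.
  have -> : e * (f * g - (f.@[c])%:MP * (g.@[c])%:MP) =
    g * (e * (f - (f.@[c])%:MP)) + (f.@[c])%:MP * (e * (g - (g.@[c])%:MP)).
    by ring.
  by apply: idealD => //; apply: idealM.
have cP a : I (e * (a%:MP - ((a%:MP : {mpoly K[m]}).@[c])%:MP)).
  by rewrite mevalC subrr mulr0; apply: ideal0.
have XP (mm : 'X_{1..m}) : I (e * ('X_[mm] - ('X_[mm].@[c])%:MP)).
  rewrite mpolyXE_id; elim/big_ind: _ => [|f g|i _]; [|exact: mulP|].
    by rewrite -mpolyC1; apply: cP.
  elim: (mm i) => [|k IHk]; first by rewrite expr0 -mpolyC1; apply: cP.
  by rewrite exprS; apply: mulP => //; rewrite mevalXU.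
elim/mpolyind => [|a mm p _ _ IHp]; first by
  rewrite meval0 mpolyC0 subrr mulr0; apply: ideal0.
rewrite mevalD mpolyCD opprD addrACA mulrDr; apply: idealD => //.
by rewrite -mul_mpolyC; apply: mulP.
Qed.

Section Nullstellensatz.
Variables (K : closedFieldType) (m : nat).
Hypothesis uncK : ~ countable [set: K].

(** Bounded degree is a finite-dimensional condition. *)
Lemma bounded_msize_dependent (N k : nat) (h : 'I_k -> {mpoly K[m]}) :
    (forall i, (msize (h i) <= N)%N) -> (#|{: 'X_{1..m < N}}| < k)%N ->
  exists2 v : 'rV[K]_k, v != 0 & \sum_i v 0 i *: h i = 0.
Proof.
move=> hN ltk; set D := #|_| in ltk.
pose M : 'M[K]_(k, D) := \matrix_(i, j) (h i)@_(enum_val j : 'X_{1..m < N}).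
have kM : kermx M != 0.
  rewrite -mxrank_eq0 mxrank_ker -lt0n subn_gt0.
  exact: leq_ltn_trans (rank_leq_col _) ltk.
have /rowV0Pn[i /sub_kermxP iM in0] := kM; exists i => //.
apply/mpolyP => mm; rewrite mcoeff0 raddf_sum /=.
have [ltmm|gemm] := ltnP (mdeg mm) N; last first.
  rewrite big1 // => j _; rewrite mcoeffZ.
  rewrite (memN_msupp_eq0 (msize_mdeg_ge _)) ?mulr0 //.
  exact: leq_trans (hN j) gemm.
have := congr1 (fun v : 'rV_D => v 0 (enum_rank (BMultinom ltmm))) iM.
rewrite mxE [RHS]mxE => eq0; rewrite -[RHS]eq0; apply: eq_bigr => j _.
by rewrite mcoeffZ !mxE enum_rankK.
Qed.

Lemma uncountable_fiber (T : Type) (f : T -> nat) : ~ countable [set: T] ->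
  exists N, infinite_set [set c | f c = N].
Proof.
move=> uncT; apply: contrapT => /forallNP fin; apply: uncT.
have -> : [set: T] = \bigcup_N [set c | f c = N].
  by apply/seteqP; split => // c _; exists (f c).
apply: bigcup_countable => // N _; apply: finite_set_countable.
exact: contrapT (fin N).
Qed.

(** Each variable takes a value modulo a proper ideal.  Otherwise all ['X_k - c]
    are invertible modulo [I]; the field being uncountable, infinitely many of
    the inverses have the same degree, hence are linearly dependent, and
    clearing denominators gives a nonzero polynomial in ['X_k] in [I].  It
    splits into invertible factors. *)
Lemma adjoin_value_proper (I : set {mpoly K[m]}) (k : 'I_m) :
    is_ideal I -> ~ I 1 ->
  exists c, ~ ideal_adjoin I ('X_k - c%:MP) 1.
Proof.
move=> idI I1; apply: contrapT => /forallNP inv.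
have {inv} /choice[h hP] c : exists a, I (1 - a * ('X_k - c%:MP)).
  by have := contrapT (inv c).
have [N infN] := uncountable_fiber (fun c => msize (h c)) uncK.
pose D := #|{: 'X_{1..m < N}}|.
have [B BN ltDB] := infinite_set_fset D.+1 infN.
pose c (i : 'I_D.+1) := nth 0 (finmap.enum_fset B) i.
have ltB (i : 'I_D.+1) : (i < size (finmap.enum_fset B))%N := leq_trans (ltn_ord i) ltDB.
have cN i : msize (h (c i)) = N by apply: BN => /=; apply: mem_nth.
have c_inj : injective c.
  by move=> i j /eqP; rewrite nth_uniq ?finmap.fset_uniq // => /eqP/val_inj.
have [|v vn0 sum0] := bounded_msize_dependent (h := h \o c) (N := N) _ (ltnSn D).
  by move=> i; rewrite /= cN.
pose p : {poly K} := \sum_i v 0 i *: \prod_(j | j != i) ('X - (c j)%:P).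
pose ev (q : {poly K}) : {mpoly K[m]} := (map_poly (@mpolyC m K) q).['X_k].
have evD q r : ev (q + r) = ev q + ev r by rewrite /ev rmorphD hornerD.
have evM q r : ev (q * r) = ev q * ev r by rewrite /ev rmorphM hornerM.
have evXsubC a : ev ('X - a%:P) = 'X_k - a%:MP.
  by rewrite /ev rmorphB /= map_polyX map_polyC hornerXsubC.
have evC a : ev a%:P = a%:MP by rewrite /ev map_polyC hornerC.
have ev_sum (F : 'I_D.+1 -> {poly K}) : ev (\sum_i F i) = \sum_i ev (F i).
  by rewrite /ev rmorph_sum horner_sum.
have ev_prod (P : pred 'I_D.+1) (F : 'I_D.+1 -> {poly K}) :
    ev (\prod_(i | P i) F i) = \prod_(i | P i) ev (F i).
  by rewrite /ev rmorph_prod horner_prod.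
have Ip : I (ev p).
  pose Q : {mpoly K[m]} := \prod_j ('X_k - (c j)%:MP).
  have -> : ev p = ev p - (\sum_i v 0 i *: h (c i)) * Q.
    by rewrite [X in X * Q]sum0 mul0r subr0.
  rewrite ev_sum mulr_suml -sumrB; apply: ideal_sum => // i _.
  rewrite -mul_polyC evM evC ev_prod -mul_mpolyC -mulrA -mulrBr.
  apply: idealM => //; under eq_bigr => j _ do rewrite evXsubC.
  rewrite [Q](bigD1 i) //= mulrA -[X in X - _]mul1r -mulrBl.
  exact: idealMr.
have pn0 : p != 0.
  have [i vi] : exists i, v 0 i != 0 by apply/rV0Pn.
  apply: contra_neq vi => p0.
  have := congr1 (fun q => q.[c i]) p0.
  rewrite horner0 horner_sum (bigD1 i) //= [X in _ + X]big1 ?addr0.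
    rewrite hornerZ horner_prod => /eqP; rewrite mulf_eq0 => /orP[/eqP //|].
    rewrite prodf_seq_eq0 => /hasP[j _ /andP[ji]].
    by rewrite hornerXsubC subr_eq0 (inj_eq c_inj) eq_sym (negPf ji).
  move=> j ji; rewrite hornerZ horner_prod (bigD1 i) 1?eq_sym //=.
  by rewrite hornerXsubC subrr mul0r mulr0.
have [r pE] := closed_field_poly_normal p.
have Iprod a : I (ev (a *: \prod_(z <- r) ('X - z%:P))) -> I a%:MP.
  elim: r {pE} => [|z r IHr]; first by rewrite big_nil alg_polyC evC.
  rewrite big_cons scalerAr evM evXsubC => Iz; apply: IHr.
  set y := ev _ in Iz *.
  apply: (ideal_congr idI _ (idealM idI (h z) Iz)).
  by rewrite mulrA -[X in X - _]mul1r -mulrBl; apply: idealMr.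
move: Ip; rewrite pE => /Iprod Il; apply: I1.
have -> : 1 = (lead_coef p)^-1%:MP * (lead_coef p)%:MP :> {mpoly K[m]}.
  by rewrite -mpolyCM mulVf ?lead_coef_eq0 // mpolyC1.
exact: idealM.
Qed.

(** Over an uncountable field the Nullstellensatz needs neither maximal ideals
    nor Noether normalization: fix the values of the variables one at a time,
    keeping the ideal proper. *)
Theorem nullstellensatz (I : set {mpoly K[m]}) : is_ideal I -> ~ I 1 ->
  exists c : 'I_m -> K, forall h, I h -> h.@[c] = 0.
Proof.
move=> idI I1.
suff [J [c [idJ J1 IJ cJ]]] : exists (J : set {mpoly K[m]}) (c : 'I_m -> K),
    [/\ is_ideal J, ~ J 1, I `<=` J & forall i, J ('X_i - (c i)%:MP)].
  exists c => h /IJ Jh; apply: contrapT => /eqP hc; apply: J1.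
  have := ideal_sub_value (e := 1) idJ (c := c).
  move=> /(_ _ h) sub; have {sub} : J (1 * (h - h.@[c]%:MP)).
    by apply: sub => i; rewrite mul1r.
  rewrite mul1r => Jhc.
  have -> : 1 = h.@[c]^-1%:MP * (h - (h - h.@[c]%:MP)) :> {mpoly K[m]}.
    by rewrite opprB addrC subrK -mpolyCM mulVf // mpolyC1.
  by apply: idealM => //; apply: idealB.
have step (k : nat) : exists (J : set {mpoly K[m]}) (c : 'I_m -> K),
    [/\ is_ideal J, ~ J 1, I `<=` J &
       forall i : 'I_m, (i < k)%N -> J ('X_i - (c i)%:MP)].
  elim: k => [|k [J [c [idJ J1 IJ cJ]]]]; first by exists I, (fun=> 0); split.
  have [ltkm|gekm] := ltnP k m; last first.
    by exists J, c; split=> // i _; apply/cJ/(leq_trans (ltn_ord i) gekm).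
  have [a Ja] := adjoin_value_proper (Ordinal ltkm) idJ J1.
  exists (ideal_adjoin J ('X_(Ordinal ltkm) - a%:MP)).
  exists (fun i => if i == Ordinal ltkm then a else c i); split => //.
  - exact: ideal_adjoin_ideal.
  - by move=> x /IJ Jx; apply: sub_ideal_adjoin.
  move=> i /=; rewrite ltnS leq_eqVlt; case: (eqVneq i (Ordinal ltkm)) => [->|ik] /=.
    by move=> _; apply: ideal_adjoin_gen.
  case/orP => [/eqP ik'|/cJ]; last by exact: sub_ideal_adjoin.
  by case/eqP: ik; apply: val_inj.
have [J [c [idJ J1 IJ cJ]]] := step m.
by exists J, c; split=> // i; apply: cJ.
Qed.

End Nullstellensatz.

(** A countable set of reals is Lebesgue negligible. *)
Lemma uncountable_reals (R : realType) : ~ countable [set: R].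
Proof.
move=> /lebesgue_measure.countable_lebesgue_measure0.
have <- : [set` `]-oo, +oo[ ] = [set: R] by apply/seteqP.
by rewrite lebesgue_measure.lebesgue_measure_itv.
Qed.

Lemma uncountable_complex (R : realType) : ~ countable [set: R[i]].
Proof.
move=> /countable_injP[f injf]; apply: (@uncountable_reals R).
apply/countable_injP; exists (f \o real_complex R) => x y _ _ /= fxy.
have [] // : real_complex R x = real_complex R y by apply: injf; rewrite ?in_setT.
Qed.

(** * The ideal of the critical scheme *)

Lemma ellE (K : fieldType) n d (A : 'M[K]_(n, d)) (b : 'cV[K]_n) x i :
  ell A b x i = \sum_k A i k * x k 0 + b i 0.
Proof. by rewrite /ell !mxE. Qed.

Definition hessian (T : comNzRingType) (n d : nat) (A : 'I_n -> 'I_d -> T)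
    (q w : 'I_n -> T) : 'M[T]_d :=
  \matrix_(j, k) \sum_i q i * A i j * A i k * w i ^+ 2.

Section CriticalPoints.
Variables (K : fieldType) (n d : nat) (A : 'M[K]_(n, d)) (b q : 'cV[K]_n).

Definition critical_point (x : 'cV[K]_d) : Prop :=
  (forall i, ell A b x i != 0) /\ (forall j, dlog A b q x j = 0).

(** The opposite of the Hessian of [sum_i q_i log l_i]. *)
Definition hess_at (x : 'cV[K]_d) : 'M[K]_d :=
  hessian A (q^~ 0) (fun i => (ell A b x i)^-1).

Definition nondegenerate : Prop :=
  forall x, critical_point x -> \det (hess_at x) != 0.

Lemma ellB x y i : ell A b y i - ell A b x i = (A *m (y - x)) i 0.
Proof. by rewrite /ell mulmxBr !mxE; ring. Qed.

Lemma critical_pairing x (v : 'cV_d) : critical_point x ->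
  \sum_i q i 0 * (A *m v) i 0 / ell A b x i = 0.
Proof.
move=> [_ dx].
transitivity (\sum_j dlog A b q x j * v j 0); last first.
  by rewrite big1 // => j _; rewrite dx mul0r.
under [RHS]eq_bigr do rewrite mulr_suml; rewrite exchange_big /=.
apply: eq_bigr => i _; rewrite mxE mulr_sumr mulr_suml.
by apply: eq_bigr => j _; rewrite -!mulrA [_^-1 * _]mulrC.
Qed.

(** The pairing of the critical equations with [y - x]. *)
Lemma critical_ratio_sum x y : critical_point x ->
  \sum_i q i 0 * (ell A b y i / ell A b x i) = \sum_i q i 0.
Proof.
move=> cx; apply/eqP; rewrite -subr_eq0 -sumrB.
rewrite -[X in _ == X](critical_pairing (y - x) cx); apply/eqP/eq_bigr => i _.
have lx : ell A b x i != 0 by case: cx.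
by rewrite -ellB; field.
Qed.

End CriticalPoints.

Section CriticalIdeal.
Variables (K : closedFieldType) (n d : nat).
Variables (A : 'M[K]_(n, d)) (b q : 'cV[K]_n).
Hypothesis uncK : ~ countable [set: K].
Local Notation P := {mpoly K[d + n]}.

Local Notation y_ k := ('X_(lshift n k) : P).
Local Notation z_ i := ('X_(rshift d i) : P).

Definition ell_poly (i : 'I_n) : P := \sum_k (A i k)%:MP * y_ k + (b i 0)%:MP.

(** The polynomial ring has a variable [z_i] for each [1 / l_i]; this relation
    says so. *)
Definition inv_rel (i : 'I_n) : P := z_ i * ell_poly i - 1.

Definition crit_rel (j : 'I_d) : P := \sum_i (q i 0 * A i j)%:MP * z_ i.

Definition lift_point (x : 'cV[K]_d) (l : 'I_(d + n)) : K :=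
  match fintype.split l with inl k => x k 0 | inr i => (ell A b x i)^-1 end.

Definition base_point (c : 'I_(d + n) -> K) : 'cV[K]_d := \col_k c (lshift n k).

Lemma lift_pointl x k : lift_point x (lshift n k) = x k 0.
Proof. by rewrite /lift_point (unsplitK (inl k)). Qed.

Lemma lift_pointr x i : lift_point x (rshift d i) = (ell A b x i)^-1.
Proof. by rewrite /lift_point (unsplitK (inr i)). Qed.

Lemma meval_ell_poly c i : (ell_poly i).@[c] = ell A b (base_point c) i.
Proof.
rewrite mevalD raddf_sum mevalC ellE; congr (_ + _); apply: eq_bigr => k _.
by rewrite /= mevalM mevalC mevalXU mxE.
Qed.

Lemma base_pointK x : base_point (lift_point x) = x.
Proof. by apply/colP => k; rewrite mxE lift_pointl. Qed.

Lemma meval_inv_rel x i : ell A b x i != 0 -> (inv_rel i).@[lift_point x] = 0.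
Proof.
move=> lx; rewrite mevalB meval1 mevalM mevalXU meval_ell_poly base_pointK.
by rewrite lift_pointr mulVf ?subrr.
Qed.

Lemma meval_crit_rel x j : (crit_rel j).@[lift_point x] = dlog A b q x j.
Proof.
rewrite raddf_sum; apply: eq_bigr => i _ /=.
by rewrite mevalM mevalC mevalXU lift_pointr.
Qed.

Section Ideal.
Variable J : set P.
Hypotheses (idJ : is_ideal J) (Jinv : forall i, J (inv_rel i)).
Hypothesis Jcrit : forall j, J (crit_rel j).

Lemma crit_ideal_zero c : (forall h, J h -> h.@[c] = 0) ->
  critical_point A b q (base_point c) /\ lift_point (base_point c) =1 c.
Proof.
move=> zc; set x := base_point c.
have cz i : c (rshift d i) * ell A b x i = 1.
  have /eqP := zc _ (Jinv i).
  by rewrite mevalB meval1 mevalM mevalXU meval_ell_poly subr_eq0 => /eqP.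
have lx i : ell A b x i != 0.
  by apply: contra_eq_neq (cz i) => ->; rewrite mulr0 eq_sym oner_neq0.
have xc : lift_point x =1 c.
  move=> l; rewrite -(splitK l); case: (fintype.split l) => [k|i] /=.
    by rewrite lift_pointl mxE.
  by rewrite lift_pointr -[RHS](mulfK (lx i)) cz mul1r.
split=> //; split=> // j; rewrite -meval_crit_rel (meval_eq _ xc).
exact: zc.
Qed.

(** The relations of [J] say that [N *m (y - x)] vanishes modulo [J] for a matrix
    [N] specializing to the Hessian at [x]; by Cramer's rule [det N] then kills
    the differences [y_k - x_k] modulo [J]. *)
Lemma crit_ideal_isolated x : critical_point A b q x ->
  exists2 e : P, e.@[lift_point x] = \det (hess_at A b q x) &
    forall h : P, J (e * (h - (h.@[lift_point x])%:MP)).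
Proof.
move=> [lx dx].
pose t i := (ell A b x i)^-1.
(* The difference quotient of [1 / l_i] is [- t_i z_i a_i]. *)
pose N : 'M[P]_d :=
  \matrix_(j, k) \sum_i (q i 0 * A i j * A i k * t i)%:MP * z_ i.
have diff i : z_ i * (t i)%:MP * (\sum_k (A i k)%:MP * (y_ k - (x k 0)%:MP)) =
    (t i)%:MP * inv_rel i + (t i)%:MP - z_ i.
  have -> : \sum_k (A i k)%:MP * (y_ k - (x k 0)%:MP) =
      ell_poly i - (ell A b x i)%:MP.
    rewrite ellE mpolyCD opprD addrACA subrr addr0.
    under eq_bigr do rewrite mulrBr; rewrite sumrB; congr (_ - _).
    by rewrite raddf_sum; apply: eq_bigr => k _; rewrite -mpolyCM.
  have tl : (t i)%:MP * (ell A b x i)%:MP = 1 :> P.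
    by rewrite -mpolyCM mulVf // mpolyC1.
  rewrite /inv_rel mulrBr mulrBr -mulrA mulr1 subrK.
  rewrite -[z_ i * _ * _ in X in _ - X]mulrA tl mulr1.
  by rewrite mulrCA.
have JN j : J (\sum_k N j k * (y_ k - (x k 0)%:MP)).
  have -> : \sum_k N j k * (y_ k - (x k 0)%:MP) =
     \sum_i (q i 0 * A i j)%:MP * ((t i)%:MP * inv_rel i) - crit_rel j.
    have dx0 : \sum_i (q i 0 * A i j)%:MP * (t i)%:MP = 0 :> P.
      transitivity ((dlog A b q x j)%:MP : P); last by rewrite dx mpolyC0.
      by rewrite raddf_sum; apply: eq_bigr => i _ /=; rewrite -mpolyCM.
    under eq_bigr => k _ do rewrite mxE mulr_suml.
    rewrite exchange_big -[RHS]addr0 -[X in _ = _ + X]dx0 -sumrB -big_split /=.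
    apply: eq_bigr => i _; rewrite -mulrBr -mulrDr addrAC -diff !mulr_sumr.
    by apply: eq_bigr => k _; rewrite !mpolyCM; ring.
  apply: idealB => //; apply: ideal_sum => // i _.
  by do 2!apply: idealM => //.
exists (\det N).
  rewrite -det_map_mx; congr (\det _); apply/matrixP => j k; rewrite !mxE.
  rewrite raddf_sum; apply: eq_bigr => i _ /=.
  by rewrite mevalM mevalC mevalXU lift_pointr expr2 !mulrA.
have Jy k : J (\det N * (y_ k - (x k 0)%:MP)).
  pose v : 'cV[P]_d := \col_k (y_ k - (x k 0)%:MP).
  have -> : \det N * (y_ k - (x k 0)%:MP) = (\adj N *m (N *m v)) k 0.
    by rewrite mulmxA mul_adj_mx mul_scalar_mx !mxE.
  rewrite mxE; apply: ideal_sum => // j _; apply: idealM => //.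
  rewrite mxE; under eq_bigr do rewrite [v _ _]mxE; exact: JN.
apply: ideal_sub_value => // l; rewrite -(splitK l).
case: (fintype.split l) => [k|i] /=; first by rewrite lift_pointl.
rewrite lift_pointr -/(t i).
have -> : z_ i - (t i)%:MP = (t i)%:MP * inv_rel i
   - z_ i * (t i)%:MP * (\sum_k (A i k)%:MP * (y_ k - (x k 0)%:MP)).
  by rewrite diff; ring.
rewrite mulrBr; apply: idealB => //; first by do 2!apply: idealM => //.
rewrite mulrCA; apply: idealM => //; rewrite mulr_sumr.
by apply: ideal_sum => // k _; rewrite mulrCA; apply: idealM.
Qed.

(** If [h] vanishes on the zeros of [J] but is not in [J], then the proper ideal
    [J : h] has a zero, which is a critical point; but [J : h] also contains a
    function not vanishing there, because [J] is the whole ideal of that point in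
    a neighborhood of it. *)
Lemma crit_ideal_radical : nondegenerate A b q -> forall h : P,
  (forall c, (forall g, J g -> g.@[c] = 0) -> h.@[c] = 0) -> J h.
Proof.
move=> nondeg h h0; apply: contrapT => Jh.
have [|c cz] := nullstellensatz uncK (colon_ideal_ideal h idJ).
  by rewrite /colon_ideal /= mul1r.
have Jc g : J g -> g.@[c] = 0 by move=> Jg; apply: cz; apply: idealMr.
have [cx xc] := crit_ideal_zero Jc.
have [e ex eP] := crit_ideal_isolated cx.
have /negP[] := nondeg _ cx; rewrite -ex (meval_eq _ xc); apply/eqP/cz.
by have := eP h; rewrite (meval_eq h xc) (h0 c Jc) mpolyC0 subr0.
Qed.

End Ideal.

(** Nondegenerate critical points are isolated, and there are finitely many of
    them: the functions vanishing at all but finitely many critical points form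
    an ideal without zeros. *)
Lemma finite_critical_points :
  nondegenerate A b q -> finite_set [set x | critical_point A b q x].
Proof.
move=> nondeg.
pose off (s : seq 'cV[K]_d) (h : P) :=
  forall x, critical_point A b q x -> x \notin s -> h.@[lift_point x] = 0.
pose J : set P := [set h | exists s, off s h].
have idJ : is_ideal J.
  split; first by exists [::] => x _ _; rewrite meval0.
    move=> f g [s fs] [t gt]; exists (s ++ t) => x cx.
    by rewrite mem_cat => /norP[xs xt]; rewrite mevalD fs // gt // addr0.
  by move=> a f [s fs]; exists s => x cx xs; rewrite mevalM fs // mulr0.
suff [s s1] : J 1.
  apply: (sub_finite_set _ (finite_seq s)) => x cx /=.
  apply: contraT => xs; have /eqP := s1 x cx xs.
  by rewrite meval1 oner_eq0.
apply: contrapT => /(nullstellensatz uncK idJ)[c cz].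
(* The local analysis applies to the ideal [V] of all critical points.  A zero of
   [J] is one of [V], while [J] also contains the functions isolating a point. *)
pose V : set P := [set h | off [::] h].
have VJ h : V h -> J h by exists [::].
have idV : is_ideal V.
  split; first by move=> x _ _; rewrite meval0.
    by move=> f g fV gV x cx xs; rewrite mevalD fV // gV // addr0.
  by move=> a f fV x cx xs; rewrite mevalM fV // mulr0.
have Vinv i : V (inv_rel i) by move=> x [lx _] _; apply: meval_inv_rel.
have Vcrit j : V (crit_rel j) by move=> x [_ dx] _; rewrite meval_crit_rel.
have [|cx xc] := @crit_ideal_zero V Vinv Vcrit c.
  by move=> h /VJ; apply: cz.
have [e ex eP] := crit_ideal_isolated idV Vinv Vcrit cx.
have /negP[] := nondeg _ cx; rewrite -ex (meval_eq _ xc); apply/eqP/cz.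
exists [:: base_point c] => x' cx'; rewrite inE => xx'.
have [k xk] : exists k, x' k 0 != base_point c k 0.
  apply/existsP; rewrite -negb_forall; apply: contra xx' => /forallP xx'.
  by apply/eqP/colP => k; apply/eqP.
have := eP (y_ k) x' cx' isT.
rewrite mevalM mevalB mevalC !mevalXU !lift_pointl => /eqP.
by rewrite mulf_eq0 subr_eq0 (negPf xk) orbF => /eqP.
Qed.

End CriticalIdeal.

Lemma add_fracX (F : fieldType) (x y D : F) (k l : nat) : D != 0 ->
  x / D ^+ k + y / D ^+ l = (x * D ^+ l + y * D ^+ k) / D ^+ (k + l).
Proof. by move=> D0; rewrite addf_div ?expf_neq0 // exprD. Qed.

Lemma inv_frac (F : fieldType) (x y : F) : y != 0 -> x^-1 = y / (x * y).
Proof. by move=> y0; rewrite invfM mulrCA divff ?mulr1. Qed.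

(** * Nondegenerate critical schemes are reduced *)

Section CoordinateRing.
Variables (R : realType) (n d : nat) (A : 'M[R[i]]_(n, d)) (b q : 'cV[R[i]]_n).
Local Notation C := (R[i]).
Local Notation FF := (funfield R d).
Hypothesis row0 : forall i, row i A != 0.

Definition affine_form (i : 'I_n) : {mpoly C[d]} :=
  \sum_k (A i k)%:MP * 'X_k + (b i 0)%:MP.

Lemma ell_genE i : ell_gen A b i = tofrac (affine_form i).
Proof.
rewrite /ell_gen ellE rmorphD rmorph_sum !mxE; congr (_ + _).
by apply: eq_bigr => k _; rewrite !mxE rmorphM.
Qed.

Lemma affine_form_neq0 i : affine_form i != 0.
Proof.
have /rV0Pn[k] := row0 i; rewrite mxE; apply: contra_neq => form0.
have := congr1 (fun p => p@_U_(k)) form0.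
rewrite mcoeff0 mcoeffD raddf_sum mcoeffC /= mnm1_eq0 mulr0 addr0.
rewrite (bigD1 k) //= mcoeffCM mcoeffXU eqxx mulr1 big1 ?addr0 // => l lk.
by rewrite mcoeffCM mcoeffXU (negPf lk) mulr0.
Qed.

Lemma ell_gen_neq0 i : ell_gen A b i != 0.
Proof. by rewrite ell_genE tofrac_eq0 affine_form_neq0. Qed.

Definition generic_value (l : 'I_(d + n)) : FF :=
  match fintype.split l with
  | inl k => tofrac ('X_k : {mpoly C[d]})
  | inr i => (ell_gen A b i)^-1
  end.

Lemma presentation_exists : exists phi : {rmorphism {mpoly C[d + n]} -> FF},
  [/\ forall c, phi c%:MP = to_ff d c,
      forall k, phi 'X_(lshift n k) = tofrac ('X_k : {mpoly C[d]}) &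
      forall i, phi 'X_(rshift d i) = (ell_gen A b i)^-1].
Proof.
pose f := (@tofrac {mpoly C[d]}) \o (@mpolyC d C).
have fC c : mmap f generic_value c%:MP = to_ff d c by rewrite mmapC.
have fX l : mmap f generic_value 'X_l = generic_value l.
  by rewrite mmapX mmap1U.
exists (mmap f generic_value); split=> [//|k|i]; apply: (etrans (fX _)).
  by rewrite /generic_value (unsplitK (inl k)).
by rewrite /generic_value (unsplitK (inr i)).
Qed.

Variable presentation : {rmorphism {mpoly C[d + n]} -> FF}.
Hypothesis presentationC : forall c, presentation c%:MP = to_ff d c.
Hypothesis presentation_l :
  forall k, presentation 'X_(lshift n k) = tofrac ('X_k : {mpoly C[d]}).
Hypothesis presentation_r :
  forall i, presentation 'X_(rshift d i) = (ell_gen A b i)^-1.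

Lemma presentation_poly (g : {mpoly C[d]}) : exists h, presentation h = tofrac g.
Proof.
elim/mpolyind: g => [|c m p _ _ [h IHp]]; first by exists 0; rewrite !raddf0.
exists (c%:MP * \prod_k 'X_(lshift n k) ^+ m k + h).
rewrite raddfD [RHS]raddfD /= IHp -mul_mpolyC mpolyXE_id; congr (_ + _).
rewrite rmorphM [RHS]rmorphM presentationC; congr (_ * _).
rewrite rmorph_prod [RHS]rmorph_prod; apply: eq_bigr => k _.
by rewrite rmorphXn [RHS]rmorphXn presentation_l.
Qed.

Lemma coord_ring_presentation f : coord_ring A b f <-> exists h, f = presentation h.
Proof.
split=> [[g [k ->]]|[h ->]].
  have [G <-] := presentation_poly g.
  exists (G * (\prod_i 'X_(rshift d i)) ^+ k).
  rewrite rmorphM rmorphXn rmorph_prod -exprVn -prodfV; congr (_ * _ ^+ _).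
  by apply: eq_bigr => i _; rewrite presentation_r.
pose D : FF := \prod_i ell_gen A b i.
have DE : D = tofrac (\prod_i affine_form i).
  by rewrite [RHS]rmorph_prod; apply: eq_bigr => i _; apply: ell_genE.
have D0 : D != 0 by apply/prodf_neq0 => i _; apply: ell_gen_neq0.
have polyP (g : {mpoly C[d]}) : coord_ring A b (tofrac g).
  by exists g, 0%N; rewrite expr0 divr1.
have addP x y : coord_ring A b x -> coord_ring A b y -> coord_ring A b (x + y).
  move=> [f' [k ->]] [g' [l ->]]; rewrite -/D (add_fracX _ _ _ _ D0).
  pose N := \prod_i affine_form i; exists (f' * N ^+ l + g' * N ^+ k), (k + l)%N.
  by rewrite -/D tofracD !tofracM !tofracXn -DE.
have mulP x y : coord_ring A b x -> coord_ring A b y -> coord_ring A b (x * y).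
  move=> [f' [k ->]] [g' [l ->]]; rewrite -/D mulf_div -exprD -tofracM.
  by exists (f' * g'), (k + l)%N.
have invP i : coord_ring A b (ell_gen A b i)^-1.
  exists (\prod_(j | j != i) affine_form j), 1%N.
  have -> : tofrac (\prod_(j | j != i) affine_form j) =
      \prod_(j | j != i) ell_gen A b j.
    by rewrite rmorph_prod; apply: eq_bigr => j _; rewrite ell_genE.
  have -> : \prod_j ell_gen A b j = ell_gen A b i * \prod_(j | j != i) ell_gen A b j.
    exact: bigD1.
  rewrite expr1; apply: inv_frac.
  by apply/prodf_neq0 => j _; apply: ell_gen_neq0.
elim/mpolyind: h => [|c m p _ _ IHp].
  by rewrite raddf0 -tofrac0; apply: (polyP).
rewrite rmorphD; apply: (addP) => //.
rewrite -mul_mpolyC rmorphM presentationC; apply: (mulP); first exact: polyP.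
rewrite mpolyXE_id rmorph_prod.
apply: (big_ind (coord_ring A b)) => [||l _]; last 1 first.
- rewrite rmorphXn; elim: (m l) => [|k IHk].
    by rewrite expr0 -tofrac1; apply: (polyP).
  rewrite exprS; apply: (mulP) => //; rewrite -(splitK l).
  case: (fintype.split l) => [j|i] /=; first by rewrite presentation_l.
  by rewrite presentation_r.
- by rewrite -tofrac1; apply: (polyP).
- exact: mulP.
Qed.

(** Every function on the complement is the image of a polynomial in the
    coordinates and the inverses of the linear forms.  Pulled back along this
    surjection, the ideal of the critical scheme becomes an ideal to which the
    local analysis above applies. *)
Lemma presented_crit_reduced : nondegenerate A b q -> crit_reduced A b q.
Proof.
move=> nondeg f m /coord_ring_presentation[h ->] Ihm.
have coordP h' : coord_ring A b (presentation h').
  by apply/coord_ring_presentation; exists h'.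
pose J : set {mpoly C[d + n]} := [set g | crit_ideal A b q (presentation g)].
have idJ : is_ideal J.
  split.
  - exists (fun=> presentation 0) => //.
    by rewrite rmorph0 big1 // => j _; rewrite mul0r.
  - move=> x y [g gP gx] [g' gP' gy]; exists (fun j => g j + g' j).
      move=> j; have /coord_ring_presentation[G ->] := gP j.
      have /coord_ring_presentation[G' ->] := gP' j.
      by rewrite -rmorphD.
    by rewrite rmorphD gx gy -big_split; apply: eq_bigr => j _; rewrite mulrDl.
  - move=> a x [g gP gx]; exists (fun j => presentation a * g j).
      move=> j; have /coord_ring_presentation[G ->] := gP j.
      by rewrite -rmorphM.
    by rewrite rmorphM gx mulr_sumr; apply: eq_bigr => j _; rewrite mulrA.
have Jinv i : J (inv_rel A b i).
  suff E : presentation (inv_rel A b i) = presentation 0.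
    by rewrite /J /= E; apply: (ideal0 idJ).
  rewrite rmorph0 rmorphB rmorph1 rmorphM presentation_r.
  have -> : presentation (ell_poly A b i) = ell_gen A b i.
    rewrite /ell_gen ellE mxE rmorphD rmorph_sum presentationC; congr (_ + _).
    by apply: eq_bigr => k _; rewrite rmorphM presentationC presentation_l !mxE.
  by rewrite mulVf ?subrr //; apply: ell_gen_neq0.
have Jcrit j : J (crit_rel A q j).
  exists (fun l => presentation (l == j)%:R) => //.
  rewrite (bigD1 j) //= eqxx rmorph1 mul1r big1 ?addr0; last first.
    by move=> l lj; rewrite (negPf lj) rmorph0 mul0r.
  rewrite rmorph_sum; apply: eq_bigr => i _.
  by rewrite rmorphM presentation_r presentationC !mxE /to_ff mpolyCM tofracM.
apply: (crit_ideal_radical (@uncountable_complex R) idJ Jinv Jcrit nondeg).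
move=> c /(_ (h ^+ m)); rewrite /J /= rmorphXn => /(_ Ihm) /eqP.
by rewrite rmorphXn expf_eq0 => /andP[_ /eqP].
Qed.

End CoordinateRing.

Lemma nondegenerate_crit_reduced (R : realType) (n d : nat)
    (A : 'M[R[i]]_(n, d)) (b q : 'cV[R[i]]_n) :
  (forall i, row i A != 0) -> nondegenerate A b q -> crit_reduced A b q.
Proof.
move=> row0; have [phi [phiC phil phir]] := presentation_exists A b.
by apply: (@presented_crit_reduced R n d A b q row0 phi).
Qed.

(** * Critical points for positive weights *)

Lemma weighted_sq_sum_eq0 (R : realDomainType) (n : nat) (w v : 'I_n -> R) :
  (forall i, 0 < w i) -> \sum_i w i * v i ^+ 2 = 0 -> forall i, v i = 0.
Proof.
move=> w0 /eqP; rewrite psumr_eq0 => [/allP v0 i|i _]; last first.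
  by rewrite mulr_ge0 ?sqr_ge0 ?ltW.
have := v0 i (mem_index_enum i); rewrite mulf_eq0 (gt_eqF (w0 i)) /=.
by rewrite expf_eq0 => /eqP.
Qed.

Lemma inj_full_rank (F : fieldType) (n d : nat) (A : 'M[F]_(n, d)) :
  \rank A = d -> forall v : 'cV_d, A *m v = 0 -> v = 0.
Proof.
move=> rA v Av; have /row_fullP[B BA] : row_full A by rewrite /row_full rA.
by rewrite -[v]mul1mx -BA -mulmxA Av mulmx0.
Qed.

Section PositiveWeights.
Variables (R : realType) (n d : nat).
Variables (A : 'M[R]_(n, d)) (b u : 'cV[R]_n).
Hypothesis rankA : \rank A = d.
Hypothesis u0 : forall i, 0 < u i 0.
Local Notation l := (ell A b).
Local Notation C := (R[i]).

Lemma ell_cplx x i : ell (cplx A) (cplx b) (cplx x) i = (l x i)%:C%C.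
Proof. by rewrite /ell -map_mxM -map_mxD mxE. Qed.

Lemma dlog_cplx x j :
  dlog (cplx A) (cplx b) (cplx u) (cplx x) j = (dlog A b u x j)%:C%C.
Proof.
rewrite /dlog rmorph_sum; apply: eq_bigr => i _.
by rewrite ell_cplx !mxE /= fmorph_div rmorphM.
Qed.

Lemma critical_cplx x :
  critical_point (cplx A) (cplx b) (cplx u) (cplx x) <-> critical_point A b u x.
Proof.
split=> -[lx dx]; split=> k.
- by have := lx k; rewrite ell_cplx fmorph_eq0.
- by have := dx k; rewrite dlog_cplx => /eqP; rewrite fmorph_eq0 => /eqP.
- by rewrite ell_cplx fmorph_eq0.
- by rewrite dlog_cplx dx rmorph0.
Qed.

(** The imaginary part of the critical equations at [x + i y] reads
    [sum_i w_i a_i (a_i . y) = 0] with positive weights [w_i]; pairing with [y]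
    gives a vanishing sum of squares. *)
Lemma critical_real z : critical_point (cplx A) (cplx b) (cplx u) z ->
  exists x, z = cplx x.
Proof.
move=> cz; have [lz dz] := cz.
pose x : 'cV[R]_d := \col_k complex.Re (z k 0).
pose y : 'cV[R]_d := \col_k complex.Im (z k 0).
have zE k : z k 0 = Complex (x k 0) (y k 0) by rewrite !mxE; case: (z k 0).
have sumC (J : finType) (f g : J -> R) :
    \sum_j Complex (f j) (g j) = Complex (\sum_j f j) (\sum_j g j).
  elim/big_rec3: _ => // j a a' c _ ->; congr Complex.
have lE i : ell (cplx A) (cplx b) z i = Complex (l x i) ((A *m y) i 0).
  rewrite !ellE !mxE -[(b i 0)%:C%C]/(Complex (b i 0) 0).
  under eq_bigr => k _.
    rewrite zE !mxE.
    have -> : (A i k)%:C%C * Complex (complex.Re (z k 0)) (complex.Im (z k 0)) =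
        Complex (A i k * x k 0) (A i k * y k 0).
      by apply/eqP; rewrite eq_complex /= !mxE !mul0r subr0 addr0 !eqxx.
    over.
  by rewrite sumC; apply/eqP; rewrite eq_complex /= addr0 !eqxx.
pose w i := u i 0 / (l x i ^+ 2 + (A *m y) i 0 ^+ 2).
have w0 i : 0 < w i.
  rewrite divr_gt0 // lt_neqAle eq_sym paddr_eq0 ?sqr_ge0 // !expf_eq0 /=.
  rewrite addr_ge0 ?sqr_ge0 // andbT; apply: contra (lz i) => /andP[/eqP l0 /eqP y0].
  by rewrite lE l0 y0; apply/eqP.
have imE j : \sum_i w i * A i j * (A *m y) i 0 = 0.
  have eq0 := congr1 (fun c => - complex.Im c) (dz j).
  rewrite -[RHS]oppr0 -[X in _ = - X]/(complex.Im (0 : C)) -[RHS]eq0.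
  rewrite /dlog; under [in RHS]eq_bigr => i _.
    rewrite !mxE -rmorphM lE.
    have -> : (u i 0 * A i j)%:C%C / Complex (l x i) ((A *m y) i 0) =
      Complex (w i * A i j * l x i) (- (w i * A i j * (A *m y) i 0)).
      apply/eqP; rewrite eq_complex /= !mul0r subr0 addr0 /w.
      by apply/andP; split; apply/eqP; ring.
    over.
  by rewrite sumC /= sumrN opprK.
have Ay : A *m y = 0.
  apply/colP => i; rewrite [RHS]mxE.
  apply: (weighted_sq_sum_eq0 (v := fun i => (A *m y) i 0) w0).
  transitivity (\sum_j (\sum_i w i * A i j * (A *m y) i 0) * y j 0); last first.
    by rewrite big1 // => j _; rewrite imE mul0r.
  under [RHS]eq_bigr do rewrite mulr_suml; rewrite exchange_big /=.
  apply: eq_bigr => k _; rewrite expr2 {1}mxE mulr_suml mulr_sumr.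
  by apply: eq_bigr => j _; ring.
exists x; apply/colP => k; rewrite zE !mxE.
by move/(inj_full_rank rankA): Ay => /colP/(_ k); rewrite !mxE => ->.
Qed.

(** The Hessian form [v |-> sum_i u_i (a_i . v)^2 / l_i^2] is positive definite. *)
Lemma det_hess_neq0 x : (forall i, l x i != 0) -> \det (hess_at A b u x) != 0.
Proof.
move=> lx; apply/det0P => -[v vn0 vH].
have v0 : v^T = 0.
  apply: (inj_full_rank rankA); apply/colP => i; rewrite [RHS]mxE.
  have w0 k : 0 < u k 0 * (l x k)^-1 ^+ 2.
    by rewrite mulr_gt0 // exprn_even_gt0 //= invr_eq0.
  apply: (weighted_sq_sum_eq0 (v := fun i => (A *m v^T) i 0) w0).
  transitivity ((v *m hess_at A b u x *m v^T) 0 0); last by rewrite vH mul0mx mxE.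
  rewrite mxE; under [RHS]eq_bigr => k _.
    rewrite !mxE; under eq_bigr => j _ do rewrite mxE mulr_sumr.
    rewrite exchange_big /= mulr_suml; over.
  rewrite exchange_big /=; apply: eq_bigr => i' _.
  rewrite [X in _ * X]expr2 {2}[(A *m _) _ _]mxE mulrA mulr_sumr.
  apply: eq_bigr => k _; rewrite [(A *m _) _ _]mxE mulr_sumr !mulr_suml.
  by apply: eq_bigr => j _; rewrite !mxE; ring.
by case/eqP: vn0; apply: trmx_inj; rewrite v0 trmx0.
Qed.

Lemma positive_nondegenerate : nondegenerate (cplx A) (cplx b) (cplx u).
Proof.
move=> z cz; have [x zx] := critical_real cz; move: cz; rewrite zx.
move=> /critical_cplx[lx _].
have -> : hess_at (cplx A) (cplx b) (cplx u) (cplx x) = cplx (hess_at A b u x).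
  apply/matrixP => j k; rewrite !mxE rmorph_sum; apply: eq_bigr => i _.
  by rewrite ell_cplx !mxE -fmorphV -rmorphXn /= -!rmorphM.
by rewrite det_map_mx fmorph_eq0 det_hess_neq0.
Qed.

(** Comparing signs by products avoids choosing a sign vector. *)
Definition cell (x : 'cV[R]_d) : set 'cV[R]_d :=
  [set y | forall i, 0 < l x i * l y i].

Lemma cell_ratio x y i : cell x y -> 0 < l y i / l x i.
Proof.
move=> /(_ i) lxy; have lx0 : l x i != 0.
  by apply: contraTneq lxy => ->; rewrite mul0r ltxx.
have -> : l y i / l x i = l x i * l y i * (l x i)^-1 ^+ 2 by field.
by rewrite mulr_gt0 // exprn_even_gt0 //= invr_eq0.
Qed.

(** With [r_i = l_i(y) / l_i(x)], criticality of both points gives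
    [sum_i u_i (r_i + r_i^-1 - 2) = 0], and [r + r^-1 >= 2]. *)
Lemma critical_cell_unique x y : critical_point A b u x ->
  critical_point A b u y -> cell x y -> x = y.
Proof.
move=> cx cy xy; have [lx _] := cx; have [ly _] := cy.
have w0 i : 0 < u i 0 / (l x i * l y i) by rewrite divr_gt0.
have sum0 : \sum_i u i 0 / (l x i * l y i) * (l y i - l x i) ^+ 2 = 0.
  transitivity (\sum_i (u i 0 * (l y i / l x i) - u i 0) +
                \sum_i (u i 0 * (l x i / l y i) - u i 0)); last first.
    by rewrite !sumrB !critical_ratio_sum // !subrr addr0.
  by rewrite -big_split; apply: eq_bigr => i _ /=; field; rewrite lx ly.
have /(inj_full_rank rankA)/eqP : A *m (y - x) = 0.
  apply/colP => i; rewrite [RHS]mxE -(ellB A b).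
  exact: (weighted_sq_sum_eq0 w0 sum0).
by rewrite subr_eq0 => /eqP.
Qed.

End PositiveWeights.

(** * Regions of the real complement *)

Section MatrixNorm.
Variable R : realType.

Lemma mx_entry_le m n (x : 'M[R]_(m, n)) i j : `|x i j| <= `|x|.
Proof.
rewrite -[leRHS]/(mx_norm x) mx_normrE.
exact: (le_bigmax _ (fun ij : 'I_m * 'I_n => `|x ij.1 ij.2|) (i, j)).
Qed.

Lemma mx_norm_le m n (x : 'M[R]_(m, n)) (M : R) :
  0 <= M -> (forall i j, `|x i j| <= M) -> `|x| <= M.
Proof.
move=> M0 xM; rewrite -[leLHS]/(mx_norm x) mx_normrE.
by apply/bigmax_leP; split=> // -[i j] _; apply: xM.
Qed.

Lemma bounded_set_entries m n (B : set 'M[R]_(m, n)) (M : R) :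
  (forall x, B x -> forall i j, `|x i j| <= M) -> bounded_set B.
Proof.
move=> BM; exists (Num.max 0 M); split; first exact: num_real.
move=> N ltN x /BM xM; apply: mx_norm_le => [|i j].
  by rewrite (le_trans _ (ltW ltN)) // le_max lexx.
by rewrite (le_trans (xM i j)) // (le_trans _ (ltW ltN)) // le_max lexx orbT.
Qed.

Lemma bounded_set_entriesP m n (B : set 'M[R]_(m, n)) :
  bounded_set B -> exists M, forall x, B x -> forall i j, `|x i j| <= M.
Proof.
move=> [M [_ BM]]; exists (M + 1) => x Bx i j.
by apply: le_trans (mx_entry_le x i j) _; apply: BM => //; rewrite ltrDl.
Qed.

End MatrixNorm.

Lemma continuous_at_sum (R : realType) (T : topologicalType) (J : finType)
    (f : J -> T -> R) (x : T) : (forall j, {for x, continuous (f j)}) ->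
  {for x, continuous (fun y => \sum_j f j y)}.
Proof.
move=> cf; elim: (index_enum J) => [|j s IHs].
  under [X in {for x, continuous X}]eq_fun do rewrite big_nil; exact: cvg_cst.
under [X in {for x, continuous X}]eq_fun do rewrite big_cons.
by apply: cvgD; [exact: cf|exact: IHs].
Qed.

Lemma continuous_at_mull (R : realType) (T : topologicalType) (f : T -> R)
    (c : R) (x : T) :
  {for x, continuous f} -> {for x, continuous (fun y => c * f y)}.
Proof. by move=> cf; apply: cvgM; [exact: cvg_cst|exact: cf]. Qed.

Lemma continuous_affine (R : realType) (T : topologicalType) (J : finType)
    (f : J -> T -> R) (c : J -> R) (e : R) : (forall j, continuous (f j)) ->
  continuous (fun y => \sum_j c j * f j y + e).
Proof.
move=> cf x; apply: cvgD; last exact: cvg_cst.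
by apply: continuous_at_sum => j; apply: continuous_at_mull; exact: cf.
Qed.

Section Regions.
Variables (R : realType) (n d : nat).
Variables (A : 'M[R]_(n, d)) (b : 'cV[R]_n).
Hypothesis rankA : \rank A = d.
Local Notation l := (ell A b).
Local Notation cell := (cell A b).

Definition real_complement : set 'cV[R]_d := [set x | forall i, l x i != 0].

Lemma cell_refl x : real_complement x -> cell x x.
Proof. by move=> lx i; rewrite -expr2 exprn_even_gt0 //= lx. Qed.

Lemma cell_complement x y : cell x y -> real_complement x /\ real_complement y.
Proof.
by move=> xy; split=> i; apply: contraTneq (xy i) => ->; rewrite ?mul0r ?mulr0 ltxx.
Qed.

Lemma continuous_ell i : continuous (fun x : 'cV[R]_d => l x i).
Proof.
have -> : (fun x : 'cV[R]_d => l x i) =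
    (fun x : 'cV[R]_d => \sum_k A i k * x k 0 + b i 0).
  by apply/funext => x; rewrite ellE.
by apply: continuous_affine => k; exact: coord_continuous.
Qed.

Lemma ell_line x (v : 'cV[R]_d) t i :
  l (x + t *: v) i = l x i + t * (A *m v) i 0.
Proof. by rewrite /ell mulmxDr -scalemxAr !mxE; ring. Qed.

Lemma ell_segment x y (t : R) i :
  l (x + t *: (y - x)) i = (1 - t) * l x i + t * l y i.
Proof.
by rewrite ell_line -(ellB A b); ring.
Qed.

(** A segment inside the convex cell joins its points; conversely a linear form
    cannot change sign on a connected set avoiding its zeros. *)
Lemma component_cell x : real_complement x ->
  connected_component real_complement x = cell x.
Proof.
move=> lx; apply/seteqP; split=> [y [B [Bx BX cB] By] i|y xy].
  rewrite ltNge; apply/negP => lxy.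
  have /connected_intervalP itvB : connected ((fun z => l z i) @` B).
    apply: connected_continuous_connected => //.
    exact/continuous_subspaceT/continuous_ell.
  have [z Bz lz] : ((fun z => l z i) @` B) 0.
    have Ix : ((fun z => l z i) @` B) (l x i) by exists x.
    have Iy : ((fun z => l z i) @` B) (l y i) by exists y.
    have [lx0|lx0] := leP 0 (l x i).
      apply: (itvB _ _ Iy Ix); rewrite lx0 andbT.
      by rewrite -(pmulr_rle0 _ (_ : 0 < l x i)) // lt_neqAle eq_sym lx.
    by apply: (itvB _ _ Ix Iy); rewrite ltW //= -(nmulr_rle0 _ lx0).
  by have /negP[] := BX z Bz i; apply/eqP.
pose f (t : R) := x + t *: (y - x).
apply: (@connected_component_max _ _ (f @` `[0, 1]%classic)).
- by exists 0; rewrite /= ?in_itv /= ?lexx ?ler01 // /f scale0r addr0.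
- move=> _ [t + <-] i; rewrite /= in_itv /= => /andP[t0 t1].
  rewrite ell_segment; apply: contraTneq (xy i) => /(congr1 ( *%R (l x i))).
  have lx2 : 0 < l x i ^+ 2 by rewrite exprn_even_gt0 //= lx.
  rewrite mulr0 => E; rewrite -leNgt; have [t01|t01] := eqVneq t 0.
    by move: E; rewrite t01 subr0 mul0r addr0 mul1r => /eqP; rewrite -expr2 gt_eqF.
  rewrite -(pmulr_rle0 _ (_ : 0 < t)) ?lt_neqAle 1?eq_sym ?t01 //.
  have -> : t * (l x i * l y i) = - ((1 - t) * l x i ^+ 2).
    by apply/eqP; rewrite -subr_eq0 -[X in _ == X]E; apply/eqP; ring.
  by rewrite oppr_le0 mulr_ge0 ?subr_ge0 // ltW.
- apply: connected_continuous_connected; first exact: segment_connected.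
  apply: continuous_subspaceT => t; apply: cvgD; first exact: cvg_cst.
  by apply: cvgZ; [exact: cvg_id|exact: cvg_cst].
- exists 1; rewrite /= ?in_itv /= ?lexx ?ler01 // /f scale1r.
  by rewrite addrC subrK.
Qed.

Section Weights.
Variable u : 'cV[R]_n.
Hypothesis u0 : forall i, 0 < u i 0.

(** The weighted sum of the positive ratios [l_i(y) / l_i(x)] is constant on the
    cell, so each ratio is bounded there. *)
Lemma critical_cell_bounded x : critical_point A b u x -> bounded_set (cell x).
Proof.
move=> cx; have [lx _] := cx; pose U := \sum_i u i 0.
have /row_fullP[B BA] : row_full A by rewrite /row_full rankA.
have ratio_le y i : cell x y -> l y i / l x i <= U / u i 0.
  move=> xy; rewrite ler_pdivlMr // /U -(critical_ratio_sum y cx) (bigD1 i) //=.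
  rewrite mulrC lerDl sumr_ge0 // => j _.
  by rewrite mulr_ge0 ?(ltW (u0 j)) // ltW // cell_ratio.
pose M i := U / u i 0 * `|l x i| + `|b i 0|.
have AM y i : cell x y -> `|(A *m y) i 0| <= M i.
  move=> xy; have -> : (A *m y) i 0 = l y i - b i 0 by rewrite /ell [in RHS]mxE addrK.
  apply: le_trans (ler_normB _ _) _; rewrite lerD2r.
  rewrite -ler_pdivrMr ?normr_gt0 // -normf_div ger0_norm ?ratio_le //.
  by rewrite ltW // cell_ratio.
apply: (@bounded_set_entries R _ _ _ (\sum_k \sum_i `|B k i| * M i)) => y xy k j.
have M0 i : 0 <= M i by apply: le_trans (AM y i xy).
rewrite (ord1 j) -[y]mul1mx -BA -mulmxA mxE.
apply: le_trans (ler_norm_sum _ _ _) _.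
rewrite (bigD1 k) //= ler_wpDr //.
  by apply: sumr_ge0 => k' _; apply: sumr_ge0 => i _; rewrite mulr_ge0.
by apply: ler_sum => i _; rewrite normrM ler_wpM2l // AM.
Qed.

(** [ln (1 + z) >= z / (1 + z)], from [ln w <= w - 1] at the inverse of [1 + z]. *)
Lemma ln1D_ge (z : R) : - 2^-1 <= z -> z - 2 * z ^+ 2 <= ln (1 + z).
Proof.
move=> hz; have z1 : 0 < 1 + z by lra.
have : ln (1 + ((1 + z)^-1 - 1)) <= (1 + z)^-1 - 1.
  by apply: le_ln1Dx; rewrite ltrBrDl subrr invr_gt0.
rewrite addrC subrK lnV ?posrE // -lerN2 opprK; apply: le_trans.
have -> : - ((1 + z)^-1 - 1) = z / (1 + z) by field; rewrite gt_eqF.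
rewrite ler_pdivlMr //.
have : 0 <= z ^+ 2 * (1 + 2 * z).
  by rewrite mulr_ge0 ?sqr_ge0 //; lra.
rewrite expr2 => h; nra.
Qed.

Definition log_potential (x y : 'cV[R]_d) : R :=
  \sum_i u i 0 * ln (l x i * l y i).

(** First-order condition, from the second-order lower bound on [ln]. *)
Lemma max_critical x p : cell x p ->
    (forall y, cell x y -> log_potential x y <= log_potential x p) ->
  critical_point A b u p.
Proof.
move=> xp pmax; have [lx lp] := cell_complement xp.
suff dir_le0 (v : 'cV_d) : \sum_i u i 0 * ((A *m v) i 0 / l p i) <= 0.
  have dir_eq0 (v : 'cV_d) : \sum_i u i 0 * ((A *m v) i 0 / l p i) = 0.
    apply/eqP; rewrite eq_le dir_le0 /= -oppr_le0 -sumrN.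
    have := dir_le0 (- v); apply: le_trans; rewrite le_eqVlt; apply/orP; left.
    apply/eqP/eq_bigr => i _; have -> : (A *m - v) i 0 = - (A *m v) i 0.
      by rewrite mulmxN [LHS]mxE.
    by rewrite mulNr mulrN.
  split=> // j; rewrite -[RHS](dir_eq0 (delta_mx j 0)); apply: eq_bigr => i _.
  by rewrite -colE mxE mulrA.
rewrite leNgt; apply/negP; set S := \sum_i _ => S0.
pose c i := (A *m v) i 0 / l p i.
pose Q := \sum_i u i 0 * c i ^+ 2; pose D := 1 + \sum_i `|c i|.
have Q0 : 0 <= Q by apply: sumr_ge0 => i _; rewrite mulr_ge0 ?sqr_ge0 ?ltW.
have D0 : 0 < D by rewrite ltr_wpDr // sumr_ge0.
have cD i : `|c i| <= D.
  by rewrite /D (bigD1 i) //= addrCA lerDl addr_ge0 // sumr_ge0.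
(* The first bound keeps [p + t v] in the cell and in the range of [ln1D_ge], the
   second one keeps the quadratic error below the linear gain [t S]. *)
pose t := Num.min (2 * D)^-1 (S / (2 * Q + 1) / 2).
have t0 : 0 < t by rewrite lt_min invr_gt0 mulr_gt0 //= !divr_gt0 //; lra.
have tD : t * D <= 2^-1 by rewrite -ler_pdivlMr // -invfM ge_min lexx.
have tQ : 2 * t * Q < S.
  have : t <= S / (2 * Q + 1) / 2 by rewrite ge_min lexx orbT.
  rewrite ler_pdivlMr // ler_pdivlMr; last lra.
  move=> tQ; apply: lt_le_trans tQ; rewrite [ltRHS]mulrDr; nra.
have tc i : `|t * c i| <= 2^-1.
  rewrite normrM (gtr0_norm t0); apply: le_trans tD.
  by rewrite ler_wpM2l // ltW.
have tcN i : - 2^-1 <= t * c i by have := tc i; rewrite ler_norml => /andP[].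
have lE i : l x i * l (p + t *: v) i = l x i * l p i * (1 + t * c i).
  by rewrite ell_line /c; field.
have xpt : cell x (p + t *: v).
  by move=> i; rewrite lE mulr_gt0 ?xp //; have := tcN i; lra.
have := pmax _ xpt; rewrite -subr_le0 -sumrB leNgt => /negP; apply.
have low : t * (S - 2 * t * Q) <=
    \sum_i (u i 0 * ln (l x i * l (p + t *: v) i) - u i 0 * ln (l x i * l p i)).
  rewrite /S /Q mulrBr !mulr_sumr -sumrB; apply: ler_sum => i _.
  rewrite lE lnM ?posrE ?xp //; last by have := tcN i; lra.
  set a := ln (l x i * l p i); rewrite -/(c i).
  have -> : u i 0 * (a + ln (1 + t * c i)) - u i 0 * a = u i 0 * ln (1 + t * c i).
    by ring.
  have -> : t * (u i 0 * c i) - t * (2 * t * (u i 0 * c i ^+ 2)) =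
      u i 0 * (t * c i - 2 * (t * c i) ^+ 2) by ring.
  by rewrite ler_wpM2l ?ln1D_ge // ltW.
by apply: lt_le_trans low; rewrite mulr_gt0 // subr_gt0.
Qed.

(** On a bounded cell the potential has an upper bound for each of its terms, so
    where some [l_i] is small it is below its value at [x]; the rest of the cell
    is compact. *)
Lemma bounded_cell_critical x : real_complement x -> bounded_set (cell x) ->
  exists2 p, critical_point A b u p & cell x p.
Proof.
move=> lx /bounded_set_entriesP[N xN].
have xx := cell_refl lx.
pose H i := `|l x i| * (\sum_k `|A i k| * N + `|b i 0|).
have upper y i : cell x y -> l x i * l y i <= H i.
  move=> xy; apply: le_trans (ler_norm _) _; rewrite normrM ler_wpM2l //.
  rewrite ellE; apply: le_trans (ler_normD _ _) _; rewrite lerD2r.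
  apply: le_trans (ler_norm_sum _ _ _) _; apply: ler_sum => k _.
  by rewrite normrM ler_wpM2l // xN.
pose T := \sum_i u i 0 * `|ln (H i)|.
(* One term below [u_i ln e_i] outweighs the upper bound [T] of the others. *)
pose e i := expR ((log_potential x x - T - 1) / u i 0).
have small y i : cell x y -> l x i * l y i < e i ->
    log_potential x y < log_potential x x.
  move=> xy ltei; rewrite /log_potential (bigD1 i) //=.
  have : u i 0 * ln (l x i * l y i) < log_potential x x - T.
    have : ln (l x i * l y i) < (log_potential x x - T - 1) / u i 0.
      by rewrite -ltr_expR lnK ?posrE ?xy.
    by rewrite ltr_pdivlMr // mulrC => h; lra.
  have : \sum_(j | j != i) u j 0 * ln (l x j * l y j) <= T.
    rewrite /T [leRHS](bigD1 i) //=; apply: ler_wpDl.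
      by rewrite mulr_ge0 // ltW.
    apply: ler_sum => j _; apply: ler_wpM2l; first by rewrite ltW.
    apply: le_trans (ler_norm _); rewrite ler_ln ?posrE ?upper //.
    exact: lt_le_trans (xy j) (upper y j xy).
  by rewrite -/(log_potential x x) => h1 h2; lra.
pose K : set 'rV[R]_d := [set v | forall i, e i <= l x i * l v^T i].
have Kcell v : K v -> cell x v^T.
  by move=> Kv i; apply: lt_le_trans (Kv i); apply: expR_gt0.
have cont i : continuous (fun v : 'rV[R]_d => l x i * l v^T i).
  have -> : (fun v : 'rV[R]_d => l x i * l v^T i) =
      (fun v => l x i * (\sum_k A i k * v 0 k + b i 0)).
    apply/funext => v; rewrite [l v^T i]ellE; congr (_ * (_ + _)).
    by apply: eq_bigr => k _; rewrite mxE.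
  have cont0 : continuous (fun v : 'rV[R]_d => \sum_k A i k * v 0 k + b i 0).
    by apply: continuous_affine => k; exact: coord_continuous.
  by move=> v; exact: (continuous_at_mull (c := l x i) (cont0 v)).
have Kcompact : compact K.
  apply: bounded_closed_compact.
    apply: (@bounded_set_entries R _ _ _ N) => v /Kcell xv i j.
    by have := xN _ xv j i; rewrite mxE.
  have -> : K = \bigcap_i [set v | e i <= l x i * l v^T i].
    by apply/seteqP; split=> [v Kv i _|v Kv i]; exact: Kv.
  apply: closed_bigI => i _.
  apply: (@preimage_closed _ _ (fun v : 'rV[R]_d => l x i * l v^T i) [set r | e i <= r]).
    by move=> v _; exact: cont.
  exact: closed_ge.
have Kx : K x^T.
  by move=> i; rewrite trmxK leNgt; apply/negP => /(small x i xx); rewrite ltxx.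
have [||p /set_mem Kp pmax] :=
  @EVT_max_rV R d (fun v => log_potential x v^T) K _ Kcompact.
- by exists x^T.
- apply/continuous_in_subspaceT => v /set_mem Kv.
  apply: continuous_at_sum => i; apply: continuous_at_mull.
  apply: (@continuous_comp _ _ _ (fun v : 'rV[R]_d => l x i * l v^T i) (@ln R)).
    exact: cont.
  apply: continuous_ln; exact: (Kcell _ Kv i).
have xp := Kcell _ Kp; exists p^T => //; apply: (max_critical xp) => y xy.
have [Ky|/existsNP[i /negP]] := pselect (K y^T).
  by have := pmax y^T (mem_set Ky); rewrite trmxK.
rewrite trmxK -ltNge => /(small y i xy)/ltW/le_trans; apply.
by have := pmax x^T (mem_set Kx); rewrite trmxK.
Qed.

End Weights.

End Regions.

(** * Elimination theory *)

Section HomogeneousComponents.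
Variables (K : comNzRingType) (m : nat).
Implicit Types (p h : {mpoly K[m]}) (mm : 'X_{1..m}).

Lemma pihomog_mulX e mm h : pihomog mdeg e ('X_[mm] * h) =
  if (mdeg mm <= e)%N then 'X_[mm] * pihomog mdeg (e - mdeg mm) h else 0.
Proof.
elim/mpolyind: h => [|c mk p _ _ IHp].
  by rewrite mulr0 !pihomog0 mulr0; case: ifP.
rewrite mulrDr pihomogD IHp -scalerAr -mpolyXD linearZ /= pihomogX mfD.
rewrite pihomogD linearZ /= pihomogX; case: leqP => [le|lt].
  rewrite mulrDr -scalerAr -{1}(subnKC le) eqn_add2l.
  by case: ifP => _; rewrite ?mulr0 // mpolyXD.
case: eqP => [E|_]; last by rewrite scaler0 addr0.
by move: lt; rewrite -E ltnNge leq_addr.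
Qed.

(** The degree [N] homogenization of the dehomogenization at ['X_i = 1]. *)
Definition rehomog (i : 'I_m) (N : nat) h : {mpoly K[m]} :=
  \sum_(e < N.+1) 'X_i ^+ (N - e) * pihomog mdeg e h.

Lemma rehomogD i N : {morph rehomog i N : x y / x + y}.
Proof.
move=> x y; rewrite /rehomog -big_split; apply: eq_bigr => e _ /=.
by rewrite pihomogD mulrDr.
Qed.

Lemma rehomogN i N : {morph rehomog i N : x / - x}.
Proof.
move=> x; rewrite /rehomog -sumrN; apply: eq_bigr => e _ /=.
by rewrite pihomogN mulrN.
Qed.

Lemma rehomog_dhomog i N h : rehomog i N h \is N.-homog.
Proof.
apply: rpred_sum => e _.
have hX : ('X_i : {mpoly K[m]}) ^+ (N - e) \is (N - e).-homog.
  by rewrite mpolyXn dhomogX /= mdegMn mdeg1 mul1n.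
by have := dhomogM hX (pihomogP mdeg e h); rewrite subnK // -ltnS.
Qed.

Lemma rehomog1 i N : rehomog i N 1 = 'X_i ^+ N.
Proof.
rewrite /rehomog big_ord_recl /= subn0 pihomog_dE ?dhomog1 // mulr1.
rewrite big1 ?addr0 // => e _; rewrite (pihomog_ne0 (d := 0%N)) ?mulr0 //.
exact: dhomog1.
Qed.

Lemma rehomog_mulX i N h : (msize h <= N)%N ->
  rehomog i N ('X_i * h) = rehomog i N h.
Proof.
move=> hN; rewrite /rehomog big_ord_recl big_ord_recr /=.
rewrite pihomog_mulX mdeg1 /= mulr0 add0r.
have -> : pihomog mdeg N h = 0.
  rewrite pihomogE big_seq_cond big_pred0 // => mm.
  apply/andP => -[/msize_mdeg_lt lt /eqP dm].
  by move: (leq_trans lt hN); rewrite dm ltnn.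
rewrite mulr0 addr0; apply: eq_bigr => e _.
rewrite pihomog_mulX mdeg1 /= subSS subn0 mulrA -exprSr.
by rewrite /bump /= add1n subnSK.
Qed.

End HomogeneousComponents.

(** The impredicative definition of the generated ideal is its own induction
    principle. *)
Definition ideal_span (T : comNzRingType) (S : set T) : set T :=
  [set h | forall I, is_ideal I -> S `<=` I -> I h].

Lemma ideal_span_ideal (T : comNzRingType) (S : set T) : is_ideal (ideal_span S).
Proof.
split=> [I idI _|x y Sx Sy I idI SI|a x Sx I idI SI]; first exact: ideal0.
  by apply: idealD => //; [exact: Sx|exact: Sy].
by apply: idealM => //; exact: Sx.
Qed.

Lemma sub_ideal_span (T : comNzRingType) (S : set T) g : S g -> ideal_span S g.
Proof. by move=> Sg I _; apply. Qed.

Lemma ideal_span_pihomog (K : comNzRingType) (m : nat) (S : set {mpoly K[m]}) :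
    (forall g, S g -> exists e, g \is e.-homog) ->
  forall h e, ideal_span S h -> ideal_span S (pihomog mdeg e h).
Proof.
move=> homS h e Sh; have idS := ideal_span_ideal S.
apply: (Sh [set h | forall e, ideal_span S (pihomog mdeg e h)]); last first.
  move=> g Sg {}e; have [e' he'] := homS g Sg.
  case: (eqVneq e' e) => [<-|ne]; first by rewrite pihomog_dE //; exact: sub_ideal_span.
  by rewrite (pihomog_ne0 ne he'); exact: ideal0.
split=> [{}e|x y Sx Sy {}e|a x Sx]; first by rewrite pihomog0; exact: ideal0.
  by rewrite pihomogD; apply: (idealD idS); [exact: Sx|exact: Sy].
elim/mpolyind: a => [|c mm p _ _ IHp] {}e.
  by rewrite mul0r pihomog0; exact: ideal0.
rewrite mulrDl pihomogD; apply: (idealD idS) => //.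
rewrite -scalerAl linearZ /= pihomog_mulX -mul_mpolyC; apply: (idealM idS).
by case: ifP => _; [apply: (idealM idS); exact: Sx|exact: ideal0].
Qed.

Section Elimination.
Variables (K : closedFieldType) (m n : nat).
Hypothesis uncK : ~ countable [set: K].
Local Notation Q := {mpoly K[n]}.
Local Notation W := {mpoly Q[m]}.
Local Notation P := {mpoly K[m]}.

(** Polynomials in the projective coordinates with coefficients depending on the
    parameters, specialized at a parameter. *)
Definition spec (q : 'I_n -> K) : W -> P := map_mpoly (meval q).

Lemma specD q : {morph spec q : x y / x + y}.
Proof. by move=> x y; rewrite /spec rmorphD. Qed.

Lemma specM q : {morph spec q : x y / x * y}.
Proof. by move=> x y; rewrite /spec rmorphM. Qed.

Lemma spec0 q : spec q 0 = 0. Proof. by rewrite /spec rmorph0. Qed.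

Lemma specX q mm : spec q 'X_[mm] = 'X_[mm].
Proof. by rewrite /spec map_mpolyX. Qed.

Lemma spec_coef q h mm : (spec q h)@_mm = (h@_mm).@[q].
Proof. by rewrite /spec mcoeff_map_mpoly. Qed.

Lemma spec_const q (p : P) : spec q (map_mpoly (@mpolyC n K) p) = p.
Proof. by apply/mpolyP => mm; rewrite spec_coef mcoeff_map_mpoly mevalC. Qed.

Lemma spec_pihomog q e h : spec q (pihomog mdeg e h) = pihomog mdeg e (spec q h).
Proof.
elim/mpolyind: h => [|c mm p _ _ IHp].
  by rewrite pihomog0 spec0 pihomog0.
rewrite pihomogD !specD pihomogD IHp; congr (_ + _).
rewrite linearZ /= pihomogX /spec !map_mpolyZ linearZ /= map_mpolyX pihomogX.
by case: ifP => _; rewrite ?map_mpolyX ?rmorph0.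
Qed.

Lemma spec_rehomog q i N h : spec q (rehomog i N h) = rehomog i N (spec q h).
Proof.
rewrite /rehomog (big_morph _ (specD q) (spec0 q)); apply: eq_bigr => e _.
by rewrite specM spec_pihomog mpolyXn specX -mpolyXn.
Qed.

Lemma spec_span_zero (S : set W) q w : (forall g, S g -> (spec q g).@[w] = 0) ->
  forall h, ideal_span S h -> (spec q h).@[w] = 0.
Proof.
move=> Sw h Sh; apply: (Sh [set h | (spec q h).@[w] = 0]) => //.
split=> /= [|x y hx hy|a x hx]; first by rewrite spec0 meval0.
  by rewrite specD mevalD hx hy addr0.
by rewrite specM mevalM hx mulr0.
Qed.

Section Family.
Variable S : set W.
Hypothesis homS : forall g, S g -> exists e, g \is e.-homog.
Variable u : 'I_n -> K.
Hypothesis zeroS : forall w, (forall g, S g -> (spec u g).@[w] = 0) ->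
  forall i, w i = 0.

(** A homogeneous system without nonzero solution at [u] has no solution with
    ['X_i = 1]; homogenizing the resulting expression of [1] gives a power of
    ['X_i]. *)
Lemma span_specializes_to_power i :
  exists N H, [/\ ideal_span S H, H \is N.-homog & spec u H = 'X_i ^+ N].
Proof.
have idS := ideal_span_ideal S.
pose J : set P := [set h | exists H h', ideal_span S H /\
  h = spec u H + h' * ('X_i - 1)].
have idJ : is_ideal J.
  split.
  - by exists 0, 0; split; [exact: (ideal0 idS)|rewrite spec0 mul0r addr0].
  - move=> _ _ [H [h [SH ->]]] [H' [h' [SH' ->]]].
    exists (H + H'), (h + h'); split; first exact: (idealD idS).
    by rewrite specD mulrDl addrACA.
  - move=> a _ [H [h [SH ->]]].
    exists (map_mpoly (@mpolyC n K) a * H), (a * h); split; first exact: (idealM idS).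
    by rewrite specM spec_const mulrDr mulrA.
have [H [h [SH E]]] : J 1.
  apply: contrapT => J1; have [c cz] := nullstellensatz uncK idJ J1.
  have c0 : forall j, c j = 0.
    apply: zeroS => g Sg; apply: cz; exists g, 0; split; first exact: sub_ideal_span.
    by rewrite mul0r addr0.
  have /cz : J ('X_i - 1).
    by exists 0, 1; split; [exact: (ideal0 idS)|rewrite spec0 mul1r add0r].
  rewrite mevalB meval1 mevalXU c0 sub0r => /eqP.
  by rewrite oppr_eq0 oner_eq0.
exists (msize h), (rehomog i (msize h) H); split.
- by apply: ideal_sum => // e _; apply: (idealM idS) => //; exact: ideal_span_pihomog.
- exact: rehomog_dhomog.
rewrite spec_rehomog -[RHS]rehomog1 E rehomogD mulrBr mulr1 rehomogD rehomogN.
by rewrite mulrC rehomog_mulX // subrr addr0.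
Qed.

Lemma span_specializes_to_monomials : exists M, forall mm, (M < mdeg mm)%N ->
  exists H, [/\ ideal_span S H, H \is (mdeg mm).-homog & spec u H = 'X_[mm]].
Proof.
have /choice[N /choice[H HP]] := span_specializes_to_power.
have idS := ideal_span_ideal S.
exists (\sum_i N i)%N => mm ltmm.
have [i leNi] : exists i, (N i <= mm i)%N.
  apply/existsP; apply: contraTT ltmm; rewrite negb_exists => /forallP lt.
  by rewrite -leqNgt mdegE; apply: leq_sum => i _; rewrite ltnW // ltnNge.
have [SH homH specH] := HP i.
have mmE : mm = (U_(i) *+ N i + (mm - U_(i) *+ N i))%MM.
  apply/mnmP => j; rewrite mnmDE mnmBE mulmnE mnm1E subnKC //.
  by case: eqP => [<-|]; rewrite ?muln1 ?mul1n // ?mul0n ?muln0.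
exists (H i * 'X_[mm - U_(i) *+ N i]); split.
- by rewrite mulrC; apply: (idealM idS).
- rewrite [in mdeg mm]mmE mdegD mdegMn mdeg1 mul1n; apply: dhomogM => //.
  by rewrite dhomogX.
by rewrite specM specH specX mpolyXn -mpolyXD -mmE.
Qed.

(** Projecting along a projective space is a closed map.  In a large degree the
    monomials are values at [u] of members of the span, so the matrix of their
    coefficients specializes to the identity at [u]; its determinant is the
    equation [F]. *)
Theorem elimination : exists F : Q, F.@[u] != 0 /\
  forall q w, (forall g, S g -> (spec q g).@[w] = 0) -> F.@[q] != 0 ->
  forall i, w i = 0.
Proof.
have [M0 HM] := span_specializes_to_monomials; pose M := M0.+1.
(* In degrees other than [M] the monomial itself serves as [H], giving identity
   rows that only say that the entries of [v] in these degrees are zero. *)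
have /choice[H HP] mm : exists H, [/\ mdeg mm = M -> ideal_span S H,
    H \is (mdeg mm).-homog & spec u H = 'X_[mm]].
  have [mmM|mmM] := eqVneq (mdeg mm) M; last first.
    exists 'X_[mm]; split; [by move/eqP: mmM|by rewrite dhomogX|exact: specX].
  by have [|H [SH hH specH]] := HM mm; [rewrite mmM|exists H].
pose T := 'X_{1..m < M.+1}.
pose B : 'M[Q]_#|{: T}| :=
  \matrix_(i, j) (H (enum_val i : T))@_(enum_val j : T).
exists (\det B); split.
  rewrite -det_map_mx (_ : map_mx _ _ = 1%:M) ?det1 ?oner_neq0 //.
  apply/matrixP => i j; rewrite !mxE /= -spec_coef; have [_ _ ->] := HP (enum_val i : T).
  by rewrite mcoeffX (inj_eq val_inj) (inj_eq enum_val_inj).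
move=> q w wz; rewrite -det_map_mx => detB.
pose v : 'cV[K]_#|{: T}| := \col_j
  (if mdeg (enum_val j : T) == M then ('X_[enum_val j : T] : P).@[w] else 0).
have Bv : map_mx (meval q) B *m v = 0.
  apply/colP => i; rewrite !mxE; have [SH homH _] := HP (enum_val i : T).
  have [iM|iM] := eqVneq (mdeg (enum_val i : T)) M; last first.
    rewrite big1 // => j _; rewrite !mxE; case: eqP => [jM|_]; last by rewrite mulr0.
    by rewrite (dhomog_nemf_coeff homH) /= ?meval0 ?mul0r // jM eq_sym.
  rewrite -[RHS](spec_span_zero wz (SH iM)).
  have szH : (msize (spec q (H (enum_val i : T))) <= M.+1)%N.
    rewrite msizeE; apply/bigmax_leqP_seq => mm; rewrite mcoeff_msupp spec_coef => Hmm _.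
    rewrite ltnS leqNgt; apply: contraNN Hmm => ltM.
    by rewrite (dhomog_nemf_coeff homH) /= ?meval0 // iM gtn_eqF.
  rewrite [in RHS](mpolywE szH) raddf_sum /= (reindex (@enum_val T predT)) /=; last first.
    exact: onW_bij (enum_val_bij _).
  apply: eq_bigr => j _; rewrite !mxE mevalZ spec_coef.
  case: eqP => [//|/eqP jM]; rewrite (dhomog_nemf_coeff homH) /= ?meval0 ?mul0r //.
  by rewrite iM.
have v0 : v = 0.
  have uB : map_mx (meval q) B \in unitmx by rewrite unitmxE unitfE.
  by rewrite -[v](mulKmx uB) Bv mulmx0.
move=> i.
have degM : (mdeg (U_(i) *+ M)%MM < M.+1)%N by rewrite mdegMn mdeg1 mul1n.
have := congr1 (fun v : 'cV_#|{: T}| => v (enum_rank (BMultinom degM)) 0) v0.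
rewrite !mxE enum_rankK /= mdegMn mdeg1 mul1n eqxx -mpolyXn rmorphXn /= mevalXU.
by move/eqP; rewrite expf_eq0 => /andP[_ /eqP].
Qed.

End Family.
End Elimination.

(** * Nondegeneracy is open at weights without vanishing partial sums *)

Section Openness.
Variables (K : closedFieldType) (n d : nat).
Variables (A : 'M[K]_(n, d)) (b : 'cV[K]_n).
Hypothesis uncK : ~ countable [set: K].
Local Notation Q := {mpoly K[n]}.
Local Notation W := {mpoly Q[1 + n]}.

(** The linear forms on [K^(1 + d)]: the coordinate of the hyperplane at infinity,
    then the homogenizations of the [l_i]. *)
Definition proj_forms : 'M[K]_(1 + n, 1 + d) := block_mx 1%:M 0 b A.
Local Notation E := proj_forms.

(** The weight at infinity makes the total weight zero. *)
Definition proj_weight (T : zmodType) (q : 'I_n -> T) (i : 'I_(1 + n)) : T :=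
  match fintype.split i with inl _ => - \sum_j q j | inr j => q j end.

Definition reciprocal (x : 'cV[K]_d) (i : 'I_(1 + n)) : K :=
  match fintype.split i with inl _ => 1 | inr j => (ell A b x j)^-1 end.

Lemma proj_weightl (T : zmodType) (q : 'I_n -> T) i :
  proj_weight q (lshift n i) = - \sum_j q j.
Proof. by rewrite /proj_weight (unsplitK (inl i)). Qed.

Lemma proj_weightr (T : zmodType) (q : 'I_n -> T) i :
  proj_weight q (rshift 1 i) = q i.
Proof. by rewrite /proj_weight (unsplitK (inr i)). Qed.

Lemma reciprocall x i : reciprocal x (lshift n i) = 1.
Proof. by rewrite /reciprocal (unsplitK (inl i)). Qed.

Lemma reciprocalr x i : reciprocal x (rshift 1 i) = (ell A b x i)^-1.
Proof. by rewrite /reciprocal (unsplitK (inr i)). Qed.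

Definition evb (q : 'I_n -> K) (w : 'I_(1 + n) -> K) : {rmorphism W -> K} :=
  GRing.RMorphism.clone _ _ (meval w \o map_mpoly (meval q)) _.

Lemma evbE q w g : (spec q g).@[w] = evb q w g. Proof. by []. Qed.

Lemma evbC q w a : evb q w a%:MP = a.@[q].
Proof. by rewrite -evbE /spec map_mpolyC mevalC. Qed.

Lemma evbX q w i : evb q w 'X_i = w i.
Proof. by rewrite -evbE specX mevalXU. Qed.

Lemma meval_proj_weight (q : 'I_n -> K) i :
  (proj_weight (fun j => 'X_j : Q) i).@[q] = proj_weight q i.
Proof.
rewrite -(splitK i); case: (fintype.split i) => j /=.
  rewrite !proj_weightl mevalN; congr (- _); rewrite raddf_sum.
  by apply: eq_bigr => k _; rewrite /= mevalXU.
by rewrite !proj_weightr mevalXU.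
Qed.

(** The critical equations, including the one for the coordinate at infinity that
    follows from the others on the graph [w_i l_i = w_0]. *)
Definition crit_form (k : 'I_(1 + d)) : W :=
  \sum_i ((E i k)%:MP * proj_weight (fun j => 'X_j : Q) i)%:MP * 'X_i.

(** A linear relation among the forms of [F], written in their reciprocals. *)
Definition circuit_form (F : {set 'I_(1 + n)}) (c : 'rV[K]_(1 + n)) : W :=
  \sum_(i in F) ((c 0 i)%:MP%:MP : W) * \prod_(j in F :\ i) 'X_j.

Definition hess_form : W :=
  \det (hessian (fun i j => ((A i j)%:MP : Q)%:MP : W) (fun i => ('X_i : Q)%:MP)
          (fun i => 'X_(rshift 1 i))).

Lemma prod_dhomog (I : finType) (P : pred I) (F : I -> W) (e : nat) :
  (forall i, P i -> F i \is e.-homog) ->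
  \prod_(i | P i) F i \is (#|P| * e).-homog.
Proof.
move=> hF; rewrite -sum1_card big_distrl /=.
apply: (big_ind2 (fun (p : W) k => p \is k.-homog)) => [|p k p' k' hp hp'|i Pi].
- exact: dhomog1.
- exact: dhomogM.
by rewrite mul1n; apply: hF.
Qed.

Lemma constM_dhomog (a : Q) (p : W) e : p \is e.-homog -> a%:MP * p \is e.-homog.
Proof. by move=> hp; rewrite mul_mpolyC; apply: dhomogZ. Qed.

Lemma X_dhomog i : ('X_i : W) \is 1.-homog.
Proof. by rewrite dhomogX /= mdeg1. Qed.

Lemma crit_form_dhomog k : crit_form k \is 1.-homog.
Proof. by apply: rpred_sum => i _; apply: constM_dhomog; apply: X_dhomog. Qed.

Lemma circuit_form_dhomog F c : circuit_form F c \is (#|F|.-1).-homog.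
Proof.
apply: rpred_sum => i iF; apply: constM_dhomog.
have -> : #|F|.-1 = (#|[pred j | j \in F :\ i]| * 1)%N.
  by rewrite muln1 (cardsD1 i F) iF /=; apply: eq_card => j; rewrite inE.
by apply: prod_dhomog => j _; apply: X_dhomog.
Qed.

Lemma det_dhomog (M : 'M[W]_d) e :
  (forall i j, M i j \is e.-homog) -> \det M \is (d * e).-homog.
Proof.
move=> hM; apply: rpred_sum => s _; set p := \prod_(i < d) _.
have hp : p \is (d * e).-homog.
  by rewrite -[X in (X * _)%N]card_ord; apply: prod_dhomog.
by case: (perm.odd_perm s); rewrite ?expr1 ?mulN1r ?dhomogN ?expr0 ?mul1r.
Qed.

Lemma hess_form_dhomog : hess_form \is (d * 2).-homog.
Proof.
apply: det_dhomog => j k; rewrite mxE; apply: rpred_sum => i _.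
rewrite -!mpolyCM; apply: constM_dhomog.
by have := dhomogMn 2 (X_dhomog (rshift 1 i)); rewrite mul1n.
Qed.

Lemma evb_crit_form q w k :
  evb q w (crit_form k) = \sum_i E i k * proj_weight q i * w i.
Proof.
rewrite rmorph_sum; apply: eq_bigr => i _.
by rewrite rmorphM evbC evbX /= mevalM mevalC meval_proj_weight.
Qed.

Lemma evb_circuit_form q w F c :
  evb q w (circuit_form F c) = \sum_(i in F) c 0 i * \prod_(j in F :\ i) w j.
Proof.
rewrite rmorph_sum; apply: eq_bigr => i _.
rewrite rmorphM evbC mevalC rmorph_prod; congr (_ * _).
by apply: eq_bigr => j _; rewrite evbX.
Qed.

Lemma evb_hess_form q w : evb q w hess_form =
  \det (hessian (fun i j => A i j) q (fun i => w (rshift 1 i))).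
Proof.
rewrite -det_map_mx; congr (\det _); apply/matrixP => j k; rewrite !mxE.
rewrite rmorph_sum; apply: eq_bigr => i _.
by rewrite 3!rmorphM rmorphXn !evbC evbX !mevalC mevalXU.
Qed.

Lemma circuit_sum (F : {set 'I_(1 + n)}) (c : 'rV[K]_(1 + n)) w :
  (forall i, i \in F -> w i != 0) ->
  \sum_(i in F) c 0 i * \prod_(j in F :\ i) w j =
  (\prod_(j in F) w j) * \sum_(i in F) c 0 i / w i.
Proof.
move=> w0; rewrite mulr_sumr; apply: eq_bigr => i iF.
rewrite [in RHS](big_setD1 i) //=; field; exact: w0.
Qed.

(** The degenerate critical points, placed in the product of weight space and
    the projective space of the [1 : 1 / l_i]. *)
Definition degenerate_graph (q : 'I_n -> K) (w : 'I_(1 + n) -> K) : Prop :=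
  exists x, [/\ critical_point A b (\col_i q i) x,
    \det (hess_at A b (\col_i q i) x) = 0 & w = reciprocal x].

(** The equations of the closure of the graph in weight space times projective
    space, hence homogeneous in the projective coordinates only. *)
Definition graph_equations : set W := [set g | (exists e, g \is e.-homog) /\
  forall q w, degenerate_graph q w -> evb q w g = 0].

Lemma reciprocal_neq0 q x i : critical_point A b q x -> reciprocal x i != 0.
Proof.
move=> [lx _]; rewrite -(splitK i); case: (fintype.split i) => j /=.
  by rewrite reciprocall oner_neq0.
by rewrite reciprocalr invr_eq0.
Qed.

Lemma proj_formsE x i :
  (E *m col_mx (1%:M : 'M_1) x) i 0 =
  match fintype.split i with inl _ => 1 | inr j => ell A b x j end.
Proof.
rewrite /E mul_block_col mul1mx mul0mx addr0 -[in LHS](splitK i).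
case: (fintype.split i) => j /=; first by rewrite col_mxEu !mxE ord1.
by rewrite col_mxEd mulmx1 addrC.
Qed.

Lemma proj_forms_reciprocal q x i : critical_point A b q x ->
  (E *m col_mx (1%:M : 'M_1) x) i 0 = (reciprocal x i)^-1.
Proof.
by rewrite proj_formsE /reciprocal; case: (fintype.split i) => j; rewrite ?invr1 ?invrK.
Qed.

Lemma graph_crit_form k : graph_equations (crit_form k).
Proof.
split=> [|q w [x [cx _ ->]]]; first by exists 1%N; exact: crit_form_dhomog.
rewrite evb_crit_form big_split_ord /= big_ord1 proj_weightl reciprocall mulr1.
under [X in _ + X]eq_bigr do rewrite proj_weightr reciprocalr.
rewrite -(splitK k); case: (fintype.split k) => j /=.
  rewrite block_mxEul mxE (ord1 j) eqxx mul1r.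
  under [X in _ + X]eq_bigr => i _.
    rewrite block_mxEdl.
    have -> : b i 0 * q i / ell A b x i = (\col_i q i) i 0 * (ell A b 0 i / ell A b x i).
      by rewrite /ell mulmx0 !mxE add0r mulrA [b i 0 * _]mulrC.
    over.
  rewrite (critical_ratio_sum 0 cx) addrC.
  by apply/eqP; rewrite subr_eq0; apply/eqP/eq_bigr => i _; rewrite mxE.
rewrite block_mxEur mxE !mul0r add0r; have [_ dx] := cx.
rewrite -[RHS](dx j) /dlog.
by apply: eq_bigr => i _; rewrite block_mxEdr mxE [A i j * _]mulrC.
Qed.

Lemma graph_circuit_form (F : {set 'I_(1 + n)}) (c : 'rV_(1 + n)) :
  (forall i, i \notin F -> c 0 i = 0) -> c *m E = 0 ->
  graph_equations (circuit_form F c).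
Proof.
move=> cF cE; split=> [|q w [x [cx _ ->]]].
  by exists #|F|.-1; exact: circuit_form_dhomog.
rewrite evb_circuit_form circuit_sum; last by move=> i _; exact: reciprocal_neq0 cx.
rewrite (_ : \sum_(i in F) _ = 0) ?mulr0 //.
transitivity ((c *m E *m col_mx (1%:M : 'M_1) x) 0 0); last by rewrite cE mul0mx mxE.
rewrite -mulmxA mxE [RHS](bigID (mem F)) /= [X in _ + X]big1 ?addr0.
  by apply: eq_bigr => i _; rewrite (proj_forms_reciprocal _ cx).
by move=> i iF; rewrite cF // mul0r.
Qed.

Lemma graph_hess_form : graph_equations hess_form.
Proof.
split=> [|q w [x [_ dx ->]]]; first by exists (d * 2)%N; exact: hess_form_dhomog.
rewrite evb_hess_form -dx; congr (\det _); apply/matrixP => j k; rewrite !mxE.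
by apply: eq_bigr => i _; rewrite mxE reciprocalr.
Qed.

Section Fiber.
Variable u : 'cV[K]_n.
Hypothesis sum_u : forall P : pred 'I_n,
  \sum_(i | P i) u i 0 = 0 -> forall i, ~~ P i.
Hypothesis nondeg_u : nondegenerate A b u.

(** On the support [F] of a solution [w], the circuit equations provide a point
    [p] at which the forms take the values [1 / w_i]; pairing the critical
    equations with [p] makes the weights of [F] sum to zero.  For weights without
    vanishing partial sums, [F] is empty or everything, and in the latter case
    [p] is a degenerate critical point. *)
Lemma fiber_trivial w : (forall g, graph_equations g -> evb (u^~ 0) w g = 0) ->
  forall i, w i = 0.
Proof.
move=> wz; pose F : {set 'I_(1 + n)} := [set i | w i != 0]%SET.
have wF i : i \in F -> w i != 0 by rewrite inE.
pose M : 'M[K]_(1 + n, 1 + d) := \matrix_(i, k) (if i \in F then E i k else 0).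
pose t : 'cV[K]_(1 + n) := \col_i (if i \in F then (w i)^-1 else 0).
have [p Ep] : exists p : 'cV_(1 + d), M *m p = t.
  suff /submxP[D tD] : (t^T <= M^T)%MS.
    by exists D^T; apply: trmx_inj; rewrite trmx_mul trmxK.
  rewrite submxE; apply/eqP/rowP => k; rewrite !mxE.
  (* A linear relation among the rows of [M] is a relation among the forms of [F]. *)
  pose c : 'rV[K]_(1 + n) := \row_i (if i \in F then cokermx M^T i k else 0).
  have cE : c *m E = 0.
    have /(congr1 (fun X : 'M_(_, _) => (col k X)^T)) := mulmx_coker M^T.
    rewrite col0 trmx0 => <-; apply/rowP => l; rewrite !mxE.
    by apply: eq_bigr => i _; rewrite !mxE; case: ifP; rewrite ?mul0r // mulrC.
  have cF i : i \notin F -> c 0 i = 0 by move=> iF; rewrite mxE (negPf iF).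
  have /eqP := wz _ (graph_circuit_form cF cE).
  rewrite evb_circuit_form circuit_sum //.
  rewrite mulf_eq0 (negPf (_ : \prod_(j in F) w j != 0)) /=; last exact/prodf_neq0.
  move=> /eqP cw; rewrite -[RHS]cw [RHS]big_mkcond /=; apply: eq_bigr => i _.
  by rewrite !mxE; case: ifP; rewrite ?mul0r // mulrC.
have EpF i : i \in F -> (E *m p) i 0 = (w i)^-1.
  move=> iF; have := congr1 (fun X : 'cV_(1 + n) => X i 0) Ep.
  rewrite [RHS]mxE iF => <-; rewrite !mxE.
  by apply: eq_bigr => k _; rewrite [in RHS]mxE iF.
have crit0 k : \sum_i E i k * proj_weight (u^~ 0) i * w i = 0.
  by rewrite -evb_crit_form; apply: wz; exact: graph_crit_form.
have sumF : \sum_(i in F) proj_weight (u^~ 0) i = 0.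
  transitivity (\sum_k (\sum_i E i k * proj_weight (u^~ 0) i * w i) * p k 0).
    under [RHS]eq_bigr do rewrite mulr_suml; rewrite exchange_big /= big_mkcond.
    apply: eq_bigr => i _; case: ifP => iF; last first.
      move: iF; rewrite inE => /negbFE/eqP wi.
      by rewrite big1 // => k _; rewrite wi mulr0 mul0r.
    transitivity (proj_weight (u^~ 0) i * w i * (E *m p) i 0).
      by rewrite EpF // mulfK // wF.
    rewrite mxE mulr_sumr; apply: eq_bigr => k _; ring.
  by rewrite big1 // => k _; rewrite crit0 mul0r.
pose inF (i : 'I_n) := rshift 1 i \in F.
have splitF : \sum_(i in F) proj_weight (u^~ 0) i =
    (if lshift n 0 \in F then - \sum_i u i 0 else 0) + \sum_(i | inF i) u i 0.
  rewrite big_mkcond big_split_ord /= big_ord1 proj_weightl; congr (_ + _).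
  by rewrite [RHS]big_mkcond; apply: eq_bigr => i _; rewrite proj_weightr.
case: (boolP (lshift n 0 \in F)) => inf; rewrite splitF ?(negPf inf) ?inf in sumF.
  exfalso.
  have allF i : inF i.
    rewrite -[inF i]negbK; apply: (@sum_u (fun i => ~~ inF i)); apply/eqP.
    rewrite -oppr_eq0 -[X in _ == X]sumF [X in _ == - X + _](bigID inF) /=.
    by rewrite opprD addrAC addNr add0r.
  have w0 := wF _ inf; set w00 := w _ in w0.
  have p0 : p (lshift d 0) 0 = w00^-1.
    rewrite -(EpF _ inf) mxE big_split_ord /= big_ord1 block_mxEul mxE mul1r.
    by rewrite big1 ?addr0 // => k _; rewrite block_mxEur mxE mul0r.
  pose x : 'cV[K]_d := \col_j (w00 * p (rshift 1 j) 0).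
  have lx i : ell A b x i = w00 / w (rshift 1 i).
    rewrite -(EpF _ (allF i)) ellE mxE big_split_ord /= big_ord1 block_mxEdl p0.
    rewrite mulrDr [w00 * (_ / _)]mulrCA divff // mulr1 addrC; congr (_ + _).
    by rewrite mulr_sumr; apply: eq_bigr => k _; rewrite block_mxEdr mxE mulrCA.
  have lxV i : (ell A b x i)^-1 = w (rshift 1 i) / w00.
    by rewrite lx invfM invrK mulrC.
  have cx : critical_point A b u x.
    split=> [i|j]; first by rewrite lx mulf_neq0 // invr_eq0 (wF _ (allF i)).
    have := crit0 (rshift 1 j); rewrite big_split_ord /= big_ord1.
    rewrite block_mxEur mxE !mul0r add0r => /(congr1 ( *%R^~ w00^-1)) crit0j.
    rewrite -[RHS](mul0r w00^-1) -[RHS]crit0j /dlog mulr_suml; apply: eq_bigr => i _.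
    by rewrite lxV block_mxEdr proj_weightr mulrA [A i j * _]mulrC.
  have := nondeg_u cx; have -> : hess_at A b u x = w00^-1 ^+ 2 *:
      hessian (fun i j => A i j) (u^~ 0) (fun i => w (rshift 1 i)).
    apply/matrixP => j k; rewrite !mxE mulr_sumr; apply: eq_bigr => i _.
    by rewrite lxV; ring.
  by rewrite detZ -(evb_hess_form _ w) wz ?mulr0 ?eqxx //; exact: graph_hess_form.
move: sumF; rewrite add0r => /sum_u nF i; apply/eqP.
have : i \notin F.
  rewrite -(splitK i); case: (fintype.split i) => j /=; last exact: nF.
  by rewrite (ord1 j).
by rewrite inE negbK.
Qed.

(** Nondegeneracy of all critical points is a Zariski open condition at such
    weights. *)
Theorem nondegenerate_open : exists F : Q, F.@[u^~ 0] != 0 /\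
  forall q : 'cV[K]_n, F.@[q^~ 0] != 0 -> nondegenerate A b q.
Proof.
have [||F [Fu FP]] := @elimination K (1 + n) n uncK graph_equations _ (u^~ 0).
- by move=> g [].
- exact: fiber_trivial.
exists F; split=> // q Fq x cx; apply/negP => /eqP dx.
have qE : \col_i q i 0 = q by apply/colP => i; rewrite mxE.
have gz g : graph_equations g -> (spec (q^~ 0) g).@[reciprocal x] = 0.
  by move=> [_ gz]; rewrite evbE; apply: gz; exists x; rewrite qE.
have /eqP := FP _ _ gz Fq (lshift n 0).
by rewrite reciprocall oner_eq0.
Qed.

End Fiber.
End Openness.

(** * Zariski closures of cones *)

Section ProjectiveClosure.
Variables (R : realType) (m : nat).
Local Notation C := (R[i]).

Lemma dhomog_meval_scale (k : nat) (F : {mpoly C[m]}) (c : C) (v : 'I_m -> C) :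
  F \is k.-homog -> F.@[fun i => c * v i] = c ^+ k * F.@[v].
Proof.
move=> hF; rewrite !mevalE mulr_sumr !big_seq; apply: eq_bigr => mm mmF.
rewrite mulrCA; congr (_ * _); under eq_bigr do rewrite exprMn.
by rewrite big_split /= prodrXr -mdegE (dhomog_mf hF mmF).
Qed.

Lemma poly_infinite_roots (p : {poly C}) : (forall c, c != 0 -> root p c) -> p = 0.
Proof.
move=> p0; apply/eqP; apply: contraT => pn0.
pose s : seq C := [seq k.+1%:R | k <- iota 0 (size p)].
have /(max_poly_roots pn0) : all (root p) s.
  by apply/allP => _ /mapP[k _ ->]; apply: p0; rewrite pnatr_eq0.
rewrite size_map size_iota ltnn => -> //.
by rewrite map_inj_uniq ?iota_uniq // => j k /eqP; rewrite eqr_nat => /eqP[].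
Qed.

(** The homogeneous components of a polynomial vanishing on a cone vanish on it,
    so that any polynomial separates a point from the closure of the cone. *)
Lemma zclosure_cone (S B : set 'cV[C]_m) (F : {mpoly C[m]}) (p : 'cV[C]_m) :
    S `<=` B -> (forall c q, c != 0 -> B q -> B (c *: q)) ->
    (forall q, B q -> F.@[q^~ 0] = 0) -> F.@[p^~ 0] != 0 ->
  ~ zclosure S p.
Proof.
move=> SB coneB FB Fp [_ clp]; case/eqP: Fp.
pose N := msize F; have FE := pihomog_partitionE (leqnn N).
rewrite FE raddf_sum big1 // => k _; apply: (clp k); first exact: pihomogP.
move=> q /SB Bq.
pose f : {poly C} := \poly_(e < N) (pihomog mdeg e F).@[q^~ 0].
have f0 : f = 0.
  apply: poly_infinite_roots => c c0; rewrite /root horner_poly; apply/eqP.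
  rewrite -[RHS](FB _ (coneB c q c0 Bq)) [in RHS]FE raddf_sum.
  apply: eq_bigr => e _ /=; rewrite mulrC -dhomog_meval_scale ?pihomogP //.
  by apply: meval_eq => i; rewrite mxE.
have := congr1 (fun g : {poly C} => g`_k) f0.
by rewrite coef_poly ltn_ord coef0.
Qed.

End ProjectiveClosure.

Section WeightScaling.
Variables (K : fieldType) (n d : nat) (A : 'M[K]_(n, d)) (b : 'cV[K]_n).

Lemma nondegenerate_scale (c : K) (q : 'cV[K]_n) :
  c != 0 -> nondegenerate A b (c *: q) -> nondegenerate A b q.
Proof.
move=> c0 nondeg x [lx dx].
have cx : critical_point A b (c *: q) x.
  split=> // j; rewrite -[RHS](mulr0 c) -(dx j) /dlog mulr_sumr.
  by apply: eq_bigr => i _; rewrite mxE !mulrA.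
have := nondeg x cx; have -> : hess_at A b (c *: q) x = c *: hess_at A b q x.
  apply/matrixP => j k; rewrite !mxE mulr_sumr; apply: eq_bigr => i _.
  by rewrite mxE !mulrA.
by rewrite detZ mulf_eq0 negb_or => /andP[].
Qed.

End WeightScaling.

(** * Counting critical points by bounded regions *)

Section Counting.
Variables (R : realType) (n d : nat).
Variables (A : 'M[R]_(n, d)) (b u : 'cV[R]_n).
Hypothesis rankA : \rank A = d.
Hypothesis u0 : forall i, 0 < u i 0.

Definition real_critical : set 'cV[R]_d := [set x | critical_point A b u x].

Lemma crit_points_real :
  crit_points (cplx A) (cplx b) (cplx u) = @cplx R d 1 @` real_critical.
Proof.
apply/seteqP; split=> [z cz|_ [x cx <-]]; last exact/critical_cplx.
by have [x zx] := critical_real rankA u0 cz; exists x => //;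
  apply/critical_cplx; rewrite -zx.
Qed.

Lemma card_crit_points :
  crit_points (cplx A) (cplx b) (cplx u) #= real_critical.
Proof.
rewrite crit_points_real; apply: inj_card_eq => x y _ _ /matrixP xy.
by apply/matrixP => i j; have := xy i j; rewrite !mxE => -[].
Qed.

Lemma bounded_regions_cells : bounded_regions A b = cell A b @` real_critical.
Proof.
have -> : bounded_regions A b =
    components (real_complement A b) `&` [set B | bounded_set B].
  congr (components _ `&` _); apply/funext => x; apply/propext.
  by split=> lx i; have := lx i; rewrite ell_cplx fmorph_eq0.
apply/seteqP; split=> [B [[x lx ->]]|_ [x cx <-]].
  rewrite /= (component_cell lx) => bx.
  have [p cp xp] := bounded_cell_critical u0 lx bx; exists p => //.
  have [_ lp] := cell_complement xp.
  rewrite -(component_cell lp) -(component_cell lx).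
  by apply/esym/same_connected_component; rewrite (component_cell lx).
have lx : real_complement A b x by case: cx.
split; last exact: critical_cell_bounded cx.
by exists x; rewrite ?component_cell.
Qed.

Lemma card_bounded_regions : bounded_regions A b #= real_critical.
Proof.
rewrite bounded_regions_cells; apply: inj_card_eq => x y /set_mem cx /set_mem cy xy.
apply: (critical_cell_unique rankA u0 cx cy); rewrite xy; apply: cell_refl.
by case: cy.
Qed.

(** Finiteness comes from the complex side, where nondegenerate critical points
    are finite in number. *)
Lemma finite_bounded_regions : finite_set (bounded_regions A b).
Proof.
have := finite_critical_points (@uncountable_complex R)
  (positive_nondegenerate (b := b) rankA u0).
by rewrite (eq_finite_set card_bounded_regions) -(eq_finite_set card_crit_points).
Qed.

End Counting.

Theorem corollary4p2 (R : realType) (n d : nat)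
    (A : 'M[R]_(n.+1, d)) (b : 'cV[R]_n.+1)
    (hd : (1 <= d)%N) (hdn : (d <= n)%N)
    (harr : is_arrangement (cplx A) (cplx b))
    (hess : essential_noncentral (cplx A) (cplx b)) :
  (exists r : nat, bounded_regions A b #= `I_r /\
     forall u : 'cV[R]_n.+1, (forall i, 0 < u i ord0) ->
       crit_points (cplx A) (cplx b) (cplx u) #= `I_r /\
       crit_reduced (cplx A) (cplx b) (cplx u)) /\
  (no_flats_at_infinity (cplx A) (cplx b) ->
     forall u : 'cV[R]_n.+1, (forall i, 0 < u i ord0) ->
       ~ log_disc (cplx A) (cplx b) (cplx u)).
Proof.
have rankA : \rank A = d by case: hess => _; rewrite mxrank_map.
have [row0 _] := harr.
have uncC := @uncountable_complex R.
split=> [|_ u u0].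
  have one0 i : 0 < (const_mx 1 : 'cV[R]_n.+1) i 0 by rewrite mxE.
  have /finite_setP[r cr] := finite_bounded_regions b rankA one0.
  exists r; split=> // u u0; split; last first.
    exact: (nondegenerate_crit_reduced row0 (positive_nondegenerate rankA u0)).
  apply: card_eq_trans (card_crit_points b rankA u0) _.
  apply: card_eq_trans cr.
  by rewrite card_eq_sym; exact: card_bounded_regions.
have sum_u (P : pred 'I_n.+1) :
    \sum_(i | P i) cplx u i 0 = 0 -> forall i, ~~ P i.
  under eq_bigr do rewrite mxE; rewrite -rmorph_sum => /eqP.
  rewrite fmorph_eq0 psumr_eq0 => [/allP sum0 i|i _]; last by rewrite ltW.
  apply/negP => Pi; have := sum0 i (mem_index_enum i).
  by rewrite Pi gt_eqF.
have [F [Fu Fnondeg]] :=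
  nondegenerate_open uncC sum_u (positive_nondegenerate (b := b) rankA u0).
apply: (zclosure_cone (B := [set q | ~ nondegenerate (cplx A) (cplx b) q]) _ _ _ Fu).
- move=> q [_ [infq|nredq]] /= nondeg.
    by apply: infq; exact: (finite_critical_points uncC nondeg).
  by apply: nredq; exact: nondegenerate_crit_reduced.
- by move=> c q c0 /= bad /(nondegenerate_scale c0).
- by move=> q /= bad; apply: contrapT => /eqP/Fnondeg.
Qed.
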